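(* Let $N\ge 2$ be an integer and let $m_0:\mathbb{T}\to\mathbb{C}$ be Lipschitz, with finitely many zeros, with $R_{m_0,m_0}1=1$ and $m_0(1)=\sqrt N$. Let $C_1,\dots,C_n$ be the $m_0$-cycles, where $C_i$ consists of the distinct points $z_{1i},\ z_{2i}=z_{1i}^N,\ \dots,\ z_{p_i i}=z_{p_i-1\, i}^N$, with $z_{p_i i}^N=z_{1i}$, $i\in\{1,\dots,n\}$. Let $g_{k,m_0,C_i}$, $k\in\{1,\dots,p_i\}$, $i\in\{1,\dots,n\}$, be the continuous functions on $\mathbb{T}$ attached to these cycles as defined in the context. If $h\in C(\mathbb{T})$, $h\ne 0$, and $R_{m_0,m_0}h=\lambda h$ for some $\lambda\in\mathbb{T}$, then there exists $i\in\{1,\dots,n\}$ such that $\lambda^{p_i}=1$, and there exist $\alpha_1,\dots,\alpha_n\in\mathbb{C}$ such that $$h=\sum_{i=1}^n\alpha_i\left(\sum_{k=1}^{p_i}\lambda^{-k+1}g_{k,m_0,C_i}\right)$$ and $\alpha_i=0$ whenever $\lambda^{p_i}\ne 1$.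
   Context: $\mathbb{T}=\{z\in\mathbb{C}:|z|=1\}$; functions on $\mathbb{T}$ are identified with $2\pi$-periodic functions on $\mathbb{R}$ via $z=e^{ix}$. The Ruelle (transfer) operator is $R_{m_0,m_0}f(z)=\frac1N\sum_{w^N=z}|m_0(w)|^2f(w)$, $z\in\mathbb{T}$. An $m_0$-cycle is a set $C=\{z_1,\dots,z_p\}\subset\mathbb{T}$ (distinct points) with $z_i^N=z_{i+1}$ for $1\le i\le p-1$, $z_p^N=z_1$, and $|m_0(z_i)|=\sqrt N$ for all $i$. For $\rho\in\mathbb{T}$, $\alpha_\rho(f)(z)=f(\rho z)$. $m_0^{(p)}(z)=m_0(z)m_0(z^N)\cdots m_0(z^{N^{p-1}})$. For $f:\mathbb{R}\to\mathbb{C}$, $\operatorname{Per}(f)(x)=\sum_{j\in\mathbb{Z}}f(x+2j\pi)$. Given an $m_0$-cycle $C=\{z_1,\dots,z_p\}$ with distinct points labelled so that $z_j^N=z_{j+1}$ for $1\le j\le p-1$ and $z_p^N=z_1$ (and $|m_0(z_j)|=\sqrt N$ for all $j$), write $m_0(z_k)=\sqrt N e^{i\theta_k}$ and $\theta_C=\theta_1+\dots+\theta_p$, and for $k\in\{1,\dots,p\}$, $x\in\mathbb{R}$ put $$\varphi_{k,m_0,C}(x)=\prod_{l=1}^\infty\frac{e^{-i\theta_C}\,\alpha_{z_k}(m_0^{(p)})\left(\frac{x}{N^{lp}}\right)}{\sqrt{N^p}},\qquad g_{k,m_0,C}=\alpha_{z_k^{-1}}\left(\operatorname{Per}|\varphi_{k,m_0,C}|^2\right).$$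 *)

(* Defs.v *)
From HB Require Import structures.
From mathcomp Require Import all_boot all_order all_algebra.
From mathcomp Require Import complex.
From mathcomp Require Import all_classical all_reals all_analysis.
From mathcomp Require showcase.summability.

Set Implicit Arguments.
Unset Strict Implicit.
Unset Printing Implicit Defensive.

Import Order.TTheory GRing.Theory Num.Theory numFieldNormedType.Exports.
Local Open Scope classical_set_scope.
Local Open Scope ring_scope.

(* Functions on the unit circle are represented by functions R[i] -> R[i] of
   which only the values on [circle] are ever constrained or used.  The
   topology and the norm on the complex numbers are those of R[i]^o. *)

Section RuelleCycles.
Variable R : realType.
Local Notation C := R[i].

Definition circle : set C^o := [set z : C | `|z| = 1].

Definition expi (x : R) : C := (cos x +i* sin x)%C.

(* Some real t with z = |z| e^{it}; it is determined modulo 2 pi when z != 0,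
   and is only used below through 2 pi-periodic quantities. *)
Definition arg (z : C) : R := xget 0 [set t | z = `|z| * expi t].

(* The function on the circle identified with the 2 pi-periodic F. *)
Definition of_periodic (F : R -> C) (z : C) : C := F (arg z).

Definition rotate_fun (rho : C) (f : C -> C) (z : C) : C := f (rho * z).

Definition ruelle (N : nat) (m0 f : C -> C) (z : C) : C :=
  N%:R^-1 * \sum_(w \in [set w | w ^+ N = z]) (`|m0 w| ^+ 2 * f w).

(* s = [:: z_1; ...; z_p] with the z_j distinct, z_j^N = z_{j+1} and
   z_p^N = z_1 (p >= 1). *)
Definition m0_cycle_labelling (N : nat) (m0 : C -> C) (s : seq C) : Prop :=
  [/\ s <> [::], uniq s, fcycle (fun w => w ^+ N) s &
      forall w, w \in s -> circle w /\ `|m0 w| = sqrtC N%:R].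

Definition m0_cycle (N : nat) (m0 : C -> C) (A : set C) : Prop :=
  exists2 s, m0_cycle_labelling N m0 s & A = [set` s].

Definition iter_filter (N : nat) (m0 : C -> C) (p : nat) (z : C) : C :=
  \prod_(j < p) m0 (z ^+ (N ^ j)).

(* Sum over Z of a family of complex numbers, as the limit of the net of its
   finite partial sums. *)
Definition Per (f : R -> C) (x : R) : C :=
  summability.sum (fun j : int => f (x + 2 * j%:~R * pi) : C^o).

Definition theta_cycle (m0 : C -> C) (s : seq C) : R :=
  \sum_(w <- s) arg (m0 w).

(* Indices are shifted by one: s`_k is the point z_{k+1} of the cycle s, and
   [phi N m0 s k], [g N m0 s k] are the functions attached to z_{k+1}. *)
Definition phi (N : nat) (m0 : C -> C) (s : seq C) (k : nat) (x : R) : C :=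
  let p := size s in
  limn (fun n => \prod_(1 <= l < n.+1)
    (expi (- theta_cycle m0 s)
     * rotate_fun s`_k (iter_filter N m0 p) (expi (x / N%:R ^+ (l * p)))
     / sqrtC (N%:R ^+ p)) : C^o).

Definition g (N : nat) (m0 : C -> C) (s : seq C) (k : nat) : C -> C :=
  rotate_fun (s`_k)^-1 (of_periodic (Per (fun x => `|phi N m0 s k x| ^+ 2))).

End RuelleCycles.

(* Main.v *)
Require Import Defs.
From HB Require Import structures.
From mathcomp Require Import all_boot all_order all_algebra.
From mathcomp Require Import complex.
From mathcomp Require Import all_classical all_reals all_analysis.
From mathcomp Require Import finmap ring lra zify.
From mathcomp Require showcase.summability.

Import Order.TTheory GRing.Theory Num.Theory numFieldNormedType.Exports.
Local Open Scope classical_set_scope.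
Local Open Scope ring_scope.
Import Normc.

Set Implicit Arguments.
Unset Strict Implicit.
Unset Printing Implicit Defensive.
Local Open Scope complex_scope.

(** Put mu = m0 / sqrt N and W = |mu|^2.  The normalization of m0 says that W is a
    probability on the N-th roots of each point of the circle, so that W drives a
    random walk X_0 = z, X_1, X_2, ... with X_(n+1)^N = X_n.  The
    eigenvalue equation says that lambda^-n h(X_n) is a bounded martingale, and the
    m0-cycles are the periodic orbits on which W = 1.  A path is absorbed by a cycle,
    in the phase that ends at its point c, exactly when X_n = c expi (x / N^n) along
    the times n that are multiples of the periods, for a real x with c expi x = z.
    This single path has probability |phi_c x|^2, written [hit c x] below, and the
    sum over all such x is g_c z, the probability to be absorbed in the phase c.  The
    theorem is the martingale identity h(z) = sum over c of g_c(z) h(c), together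
    with the relation h(z_(k+1)) = lambda^-k h(z_1) along each cycle: so alpha_i is
    h(z_1i), which is multiplied by lambda^(p_i) around the cycle and vanishes unless
    lambda^(p_i) = 1.  As h does not vanish identically, some cycle has
    lambda^(p_i) = 1.

    The proof only uses finite sums.  For finitely many lifts (c, x) of z and n a
    large multiple of the periods, the points c expi (x / N^n) are distinct N^n-th
    roots of z, and all the other roots share the remaining probability; hence
    |h(z) - sum (hit c x) h(c)| <= M (1 - sum (hit c x)) when |h| <= M
    ([cycle_sum_bound]).  For h = 1 this bounds the sums by 1, and in general it
    reduces the theorem to the fact that absorption is almost sure: the supremum
    [hit_total] of these sums is 1 ([hit_total1]).

    This is a minimum principle.  [hit_total] is superharmonic and lower
    semicontinuous, so its minimum is attained, on a set A which contains every root
    of positive weight of each of its points.  If some point expi t of A meets no zero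
    of W in its backward tree, then A contains every expi (t / N^n); these points
    tend to 1, where [hit_total] is 1 since m0 1 = sqrt N.  Otherwise, a point of A
    that is not periodic would see the finitely many zeros of W at a bounded depth
    only, and the points of A further back would have zero-free trees; so all points
    of A are periodic, the weight of each of them is carried by its periodic root,
    and A contains an m0-cycle, on which [hit_total] is 1 too.

    The analytic input is one estimate, [iter_filter_lip]: since the factors of the
    iterated filter have modulus at most 1 and are Lipschitz, the product along
    c expi (x / N^n) is a Lipschitz function of x with a constant that does not depend
    on n.  It gives the convergence of the products phi and the semicontinuity of
    [hit_total]. *)

(** * Moduli and the parametrization of the circle *)

Section Modulus.
Variable R : realType.
Implicit Types (u v z w : R[i]) (x y : R).

Lemma normCE z : `|z| = (normc z)%:C. Proof. by []. Qed.

Lemma normc_ge0 z : 0 <= normc z.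
Proof. by rewrite -lecR -normCE normr_ge0. Qed.

Lemma ler_normcD u v : normc (u + v) <= normc u + normc v.
Proof. by rewrite -lecR rmorphD /= -!normCE ler_normD. Qed.

Lemma normcN z : normc (- z) = normc z.
Proof. by apply: complexI; rewrite -!normCE normrN. Qed.

Lemma normcBC u v : normc (u - v) = normc (v - u).
Proof. by rewrite -normcN opprB. Qed.

Lemma ler_normcB w u v : normc (u - v) <= normc (u - w) + normc (w - v).
Proof. by have := ler_normcD (u - w) (w - v); rewrite addrA subrK. Qed.

Lemma normcX z n : normc (z ^+ n) = normc z ^+ n.
Proof. by apply: complexI; rewrite rmorphXn /= -!normCE normrX. Qed.

Lemma normc_real x : normc x%:C = `|x|.
Proof. by rewrite /normc /= expr0n addr0 sqrtr_sqr. Qed.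

Lemma ler_normc_sum (I : Type) (s : seq I) (P : pred I) (F : I -> R[i]) :
  normc (\sum_(i <- s | P i) F i) <= \sum_(i <- s | P i) normc (F i).
Proof.
elim/big_rec2: _ => [|i y z _ le_zy]; first by rewrite normc0.
by rewrite (le_trans (ler_normcD _ _))// lerD2l.
Qed.

Lemma normc_prod (I : Type) (s : seq I) (P : pred I) (F : I -> R[i]) :
  normc (\prod_(i <- s | P i) F i) = \prod_(i <- s | P i) normc (F i).
Proof. by apply: (big_morph (@normc R) (@normcM _) (@normc1 _)). Qed.

Lemma sqr_normC z : `|z| ^+ 2 = (normc z ^+ 2)%:C.
Proof. by rewrite normCE rmorphXn. Qed.

Lemma circleE z : circle z = (normc z = 1) :> Prop.
Proof.
rewrite /circle /= normCE; apply/propext; split=> [|->] //.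
exact: (@complexI R _ 1).
Qed.

Lemma circleM u v : circle u -> circle v -> circle (u * v).
Proof. by rewrite !circleE normcM => -> ->; rewrite mulr1. Qed.

Lemma circleX z n : circle z -> circle (z ^+ n).
Proof. by rewrite !circleE normcX => ->; rewrite expr1n. Qed.

Lemma circle1 : circle (1 : R[i]).
Proof. by rewrite circleE normc1. Qed.

Lemma circle_neq0 z : circle z -> z != 0.
Proof.
by rewrite circleE => z1; apply: contra_eq_neq z1 => ->; rewrite normc0 eq_sym oner_eq0.
Qed.

Lemma circleV z : circle z -> circle z^-1.
Proof. by rewrite !circleE normcV => ->; rewrite invr1. Qed.

End Modulus.

Section Expi.
Variable R : realType.
Implicit Types (z : R[i]) (x y t : R).

Lemma expi0 : expi 0 = 1 :> R[i].
Proof. by rewrite /expi cos0 sin0. Qed.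

Lemma expiD x y : expi (x + y) = expi x * expi y :> R[i].
Proof.
rewrite /expi cosD sinD; apply/eqP; rewrite eq_complex /= eqxx /=.
by apply/eqP; ring.
Qed.

Lemma expi_sum (I : Type) (s : seq I) (F : I -> R) :
  expi (\sum_(i <- s) F i) = \prod_(i <- s) expi (F i).
Proof. by apply: (big_morph _ expiD expi0). Qed.

Lemma expiX x n : expi x ^+ n = expi (x * n%:R).
Proof.
elim: n => [|n IH]; first by rewrite mulr0 expi0.
by rewrite exprS IH -expiD -natr1 mulrDr mulr1 addrC.
Qed.

Lemma normc_expi x : normc (expi x) = 1.
Proof. by rewrite /normc /= cos2Dsin2 sqrtr1. Qed.

Lemma circle_expi x : circle (expi x).
Proof. by rewrite circleE normc_expi. Qed.

Lemma expiN x : expi (- x) = (expi x)^-1 :> R[i].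
Proof.
have nz := circle_neq0 (circle_expi x).
by apply: (mulfI nz); rewrite mulfV// -expiD subrr expi0.
Qed.

Lemma lip1_of_deriv (f f' : R -> R) :
  (forall x, is_derive x (1 : R) f (f' x)) -> (forall x, `|f' x| <= 1) ->
  forall x y, `|f x - f y| <= `|x - y|.
Proof.
move=> df f'1.
suff H x y : y <= x -> `|f x - f y| <= `|x - y|.
  move=> x y; have [|/ltW] := leP y x; first exact: H.
  by move=> xy; rewrite distrC [leRHS]distrC; exact: H.
move=> yx; have fc : {within `[y, x], continuous f}.
  apply: continuous_subspaceT => u; apply: differentiable_continuous.
  by apply/derivable1_diffP; have [] := df u.
have [c _ ->] := MVT_segment yx (fun u _ => df u) fc.
by rewrite normrM ler_piMl.
Qed.

Lemma expi_lip x y : normc (expi x - expi y) <= 2 * `|x - y|.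
Proof.
have dc := @lip1_of_deriv cos (fun x => - sin x) (fun x => @is_derive_cos R x).
have ds := @lip1_of_deriv sin cos (fun x => @is_derive_sin R x).
have -> : expi x - expi y = (cos x - cos y)%:C + 'i * (sin x - sin y)%:C :> R[i].
  by rewrite /expi; apply/eqP; rewrite eq_complex /=; apply/andP; split; apply/eqP; ring.
rewrite (le_trans (ler_normcD _ _))// normcM !normc_real.
have -> : normc ('i : R[i]) = 1 by rewrite /normc /= expr0n expr1n add0r sqrtr1.
rewrite mul1r mulr2n mulrDl mul1r lerD//.
  by apply: dc => t; rewrite normrN sin_max.
by apply: ds => t; exact: cos_max.
Qed.

(** The interval is kept because the compactness arguments on the circle are carried out on
    [-pi, pi]. *)
Lemma expi_surj z : circle z -> exists2 t, z = expi t & t \in `[- pi, pi].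
Proof.
case: z => a b; rewrite circleE /normc => /(congr1 (fun x => x ^+ 2)).
rewrite sqr_sqrtr ?addr_ge0 ?sqr_ge0// expr1n => ab1.
have a1 : -1 <= a <= 1.
  rewrite -ler_norml -(ler_pXn2r (n := 2))//= ?nnegrE// expr1n real_normK ?num_real//.
  by rewrite -ab1 lerDl sqr_ge0.
have ain : a \in `[(-1), 1] by rewrite in_itv.
have sb : Num.sqrt (1 - a ^+ 2) = `|b| by rewrite -ab1 addrAC subrr add0r sqrtr_sqr.
have [b0|b0] := leP 0 b.
  exists (acos a); first by rewrite /expi acosK// sin_acos// sb ger0_norm.
  by rewrite in_itv /= acos_lepi// (le_trans _ (acos_ge0 a1))// oppr_le0 pi_ge0.
exists (- acos a); first by rewrite /expi cosN sinN acosK// sin_acos// sb ltr0_norm// opprK.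
by rewrite in_itv /= lerN2 acos_lepi// (le_trans _ (pi_ge0 R))// oppr_le0 acos_ge0.
Qed.

Lemma argP z : z = `|z| * expi (arg z).
Proof.
rewrite /arg; set A := [set t | _]; suff A0 : exists t, A t by exact: (xgetPex 0 A0).
have [z0|z0] := eqVneq z 0; first by exists 0; rewrite /A/= z0 normr0 mul0r.
have nz : normc z != 0 by apply: contra z0 => /eqP/eq0_normc ->.
have [|t e _] := @expi_surj (z / `|z|).
  rewrite circleE normcM normcV normCE normc_real ger0_norm ?normc_ge0//.
  by rewrite mulfV.
by exists t; rewrite /A /= -e mulrC divfK// normr_eq0.
Qed.

Lemma expi_arg z : circle z -> expi (arg z) = z.
Proof. by rewrite /circle/= => z1; rewrite [RHS]argP z1 mul1r. Qed.

Lemma expi2pi (k : int) : expi (2 * k%:~R * pi) = 1 :> R[i].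
Proof.
have H n : expi (2 * n%:R * pi) = 1 :> R[i].
  have -> : 2 * n%:R * pi = (2 * pi) * n%:R :> R by ring.
  by rewrite -expiX /expi mulr_natl cos2pi sin2pi expr1n.
case: k => n; first exact: H.
by rewrite NegzE mulrNz mulrN mulNr expiN -pmulrn H invr1.
Qed.

Lemma expi_eq1 x : expi x = 1 :> R[i] -> exists k : int, x = 2 * k%:~R * pi.
Proof.
move=> ex1; have p0 : 0 < 2 * pi :> R by rewrite mulr_gt0 ?pi_gt0.
exists (Num.floor (x / (2 * pi))); set k := Num.floor _.
have /andP[k1 k2] := floor_itv (x / (2 * pi)).
rewrite -/k ler_pdivlMr// ltr_pdivrMr// in k1 k2.
set y := x - k%:~R * (2 * pi).
have y0 : 0 <= y by rewrite subr_ge0.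
have y2 : y < 2 * pi by move: k2; rewrite /y intrD; lra.
suff : y = 0 by rewrite /y => /eqP; rewrite subr_eq0 => /eqP ->; ring.
have : expi y = 1 :> R[i].
  rewrite /y expiD ex1 mul1r; have := expi2pi (- k); rewrite mulrNz.
  by rewrite [X in expi X](_ : _ = - (k%:~R * (2 * pi)))//; ring.
rewrite /expi => -[c1 _].
have pi0 := @pi_gt0 R.
have [yp|yp] := leP y pi.
  by apply: cos_inj; rewrite ?in_itv /= ?y0 ?yp ?lexx ?ltW ?cos0.
have : 2 * pi - y = 0.
  have r1 : 0 <= 2 * pi - y by lra.
  have r2 : 2 * pi - y <= pi by lra.
  apply: cos_inj; rewrite ?in_itv /= ?r1 ?r2 ?lexx ?ltW ?cos0//.
  by rewrite mulr_natl -cosN opprB cosB cos2pi sin2pi c1 mulr1 mulr0 addr0.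
lra.
Qed.

Lemma expi_eq1_small x : `|x| < 1 -> expi x = 1 :> R[i] -> x = 0.
Proof.
move=> x1 /expi_eq1[k xE]; rewrite xE; have [->|k0] := eqVneq k 0; first by ring.
exfalso; move: x1; apply/negP; rewrite -leNgt xE !normrM.
have k1 : 1 <= `|k%:~R| :> R by rewrite -intr_norm (ler_int _ 1) -gtz0_ge1 normr_gt0.
rewrite ger0_norm// (ger0_norm (pi_ge0 R)).
have := @pi_ge2 R; nra.
Qed.

End Expi.

(** * Sequences, sums and functions on the circle *)

(** Telescoping: replacing the factors one at a time costs one difference each, the
    other factors being bounded by 1. *)
Lemma normc_prod_dist (R : realType) (a b : nat -> R[i]) n :
  (forall j, normc (a j) <= 1) -> (forall j, normc (b j) <= 1) ->
  normc (\prod_(j < n) a j - \prod_(j < n) b j) <=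
    \sum_(j < n) normc (a j - b j).
Proof.
move=> a1 b1; elim: n => [|n IH]; first by rewrite !big_ord0 subrr normc0.
rewrite !big_ord_recr /=; set p := \prod_(j < n) a j; set q := \prod_(j < n) b j.
have -> : p * a n - q * b n = (p - q) * b n + p * (a n - b n) by ring.
rewrite (le_trans (ler_normcD _ _))// !normcM lerD//.
  by rewrite (le_trans _ IH)// ler_piMr ?normc_ge0.
rewrite ler_piMl ?normc_ge0// normc_prod (@Num.Theory.prodr_ile1 R)// => i _.
by rewrite normc_ge0 a1.
Qed.

Lemma sum_expn_le N n : (1 < N)%N -> (\sum_(j < n) N ^ j <= N ^ n)%N.
Proof.
move=> N1; elim: n => [|n IH]; first by rewrite big_ord0.
rewrite big_ord_recr /= expnS (leq_trans (leq_add IH (leqnn _)))//.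
by rewrite addnn -mul2n leq_mul2r N1 orbT.
Qed.

Lemma squeeze_cvg0 (R : realType) (f g : nat -> R) :
  (forall n, 0 <= f n <= g n) -> g n @[n --> \oo] --> (0 : R) ->
  f n @[n --> \oo] --> (0 : R).
Proof.
move=> fg g0; apply: (@squeeze_cvgr _ _ _ _ (fun=> 0) g) => //; last exact: cvg_cst.
exact: nearW.
Qed.

Lemma cvg_sum_seq (R : realType) (I : eqType) (s : seq I)
    (f : I -> nat -> R) (l : I -> R) :
  (forall i, i \in s -> f i n @[n --> \oo] --> l i) ->
  \sum_(i <- s) f i n @[n --> \oo] --> \sum_(i <- s) l i.
Proof.
elim: s => [|i s IH] fl.
  by under eq_fun do rewrite big_nil; rewrite big_nil; exact: cvg_cst.
under eq_fun do rewrite big_cons; rewrite big_cons; apply: cvgD.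
  by apply: fl; rewrite mem_head.
by apply: IH => j js; apply: fl; rewrite inE js orbT.
Qed.

Lemma Re_le_normc (R : realType) (z : R[i]) : `|complex.Re z| <= normc z.
Proof. by rewrite -lecR -normCE normc_ge_Re. Qed.

Lemma Im_le_normc (R : realType) (z : R[i]) : `|complex.Im z| <= normc z.
Proof.
case: z => a b; have := Re_le_normc (b +i* a).
by rewrite /normc /= addrC.
Qed.

Lemma normc_le_Re_Im (R : realType) (z : R[i]) :
  normc z <= `|complex.Re z| + `|complex.Im z|.
Proof.
case: z => x y; rewrite [leLHS](_ : _ = normc (x%:C + 'i%C * y%:C)).
  rewrite (le_trans (ler_normcD _ _))// normcM !normc_real.
  by rewrite (_ : normc 'i%C = 1) ?mul1r// /normc /= expr0n expr1n add0r sqrtr1.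
congr normc; apply/eqP; rewrite eq_complex /=; apply/andP; split; apply/eqP; ring.
Qed.

(** A Cauchy criterion in which the rate [b n] bounds all later increments; it is used for
    products in which the tail from n on is a rescaled copy of the whole product. *)
Lemma cauchy_rate_cvg (R : realType) (a b : nat -> R) :
  (forall n m, `|a (n + m)%N - a n| <= b n) -> b n @[n --> \oo] --> (0 : R) ->
  cvgn a.
Proof.
move=> ab b0; apply/cauchy_cvgP/cauchy_exP => e e0.
have [n _ /(_ n (leqnn n)) bn] := cvgr0_norm_lt _ b0 _ e0.
exists (a n); exists n => // m /= nm; rewrite /ball /= distrC -(subnKC nm).
exact: (le_lt_trans (ab _ _) (le_lt_trans (ler_norm _) bn)).
Qed.

Lemma cvg_complexP (R : realType) (u : nat -> R[i]^o) (l : R[i]^o) :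
  normc (l - u n) @[n --> \oo] --> (0 : R) -> u n @[n --> \oo] --> l.
Proof.
move=> ul; apply/cvgrPdist_lt => e; case: e => e e' /=; rewrite ltcE /= => /andP[/eqP -> e0].
near=> n; have : `|normc (l - u n)| < e by near: n; exact: cvgr0_norm_lt ul _ e0.
by rewrite ger0_norm ?normc_ge0// -ltcR.
Unshelve. all: by end_near. Qed.

Lemma cauchy_rate_cvg_complex (R : realType) (u : nat -> R[i]) (b : nat -> R) :
  (forall n m, normc (u (n + m)%N - u n) <= b n) -> b n @[n --> \oo] --> (0 : R) ->
  exists l, normc (l - u n) @[n --> \oo] --> (0 : R).
Proof.
move=> ub b0.
have re : cvgn (fun n => complex.Re (u n)).
  apply: cauchy_rate_cvg b0 => n m; apply: le_trans (ub n m).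
  rewrite (_ : complex.Re _ - _ = complex.Re (u (n + m)%N - u n)) ?Re_le_normc//.
  by case: (u _) (u _) => ? ? [].
have im : cvgn (fun n => complex.Im (u n)).
  apply: cauchy_rate_cvg b0 => n m; apply: le_trans (ub n m).
  rewrite (_ : complex.Im _ - _ = complex.Im (u (n + m)%N - u n)) ?Im_le_normc//.
  by case: (u _) (u _) => ? ? [].
set a := limn _ in re *; set a' := limn _ in im *; exists (a +i* a')%C.
apply: (squeeze_cvg0 (g := fun n => `|a - complex.Re (u n)| + `|a' - complex.Im (u n)|)) => [n|].
  rewrite normc_ge0; apply: (le_trans (normc_le_Re_Im _)).
  by case: (u n) => x y /=.
rewrite -[X in _ --> X]addr0; apply: cvgD.
  by apply/norm_cvg0P; rewrite -[X in _ --> X](subrr a); apply: cvgB => //; exact: cvg_cst.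
by apply/norm_cvg0P; rewrite -[X in _ --> X](subrr a'); apply: cvgB => //; exact: cvg_cst.
Qed.

Lemma ler_sum_subseq (R : realType) (I : eqType) (s t : seq I) (a : I -> R) :
  uniq s -> uniq t -> {subset s <= t} -> (forall i, i \in t -> 0 <= a i) ->
  \sum_(i <- s) a i <= \sum_(i <- t) a i.
Proof.
move=> us ut st a0; have st_perm : perm_eq s [seq i <- t | i \in s].
  apply: uniq_perm => //; first exact: filter_uniq.
  by move=> i; rewrite mem_filter; apply/idP/andP => [si|[]//]; split=> //; exact: st.
rewrite (perm_big _ st_perm) big_filter big_mkcond big_seq [leRHS]big_seq.
by apply: ler_sum => i it; case: ifP => // _; exact: a0.
Qed.

Section NonnegativeSum.
Variables (R : realType) (a : int -> R).
Hypothesis a_ge0 : forall j, 0 <= a j.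

Lemma fset_partial_sumE (F : {fset int}) :
  summability.partial_sum (fun j => (a j)%:C : R[i]^o) F = (\sum_(j <- F) a j)%:C.
Proof.
rewrite /summability.partial_sum rmorph_sum /=.
by rewrite [RHS](big_seq_fsetE _ F xpredT (fun j => (a j)%:C)).
Qed.

Lemma fset_sum_le (F G : {fset int}) : (F `<=` G)%fset ->
  \sum_(j <- F) a j <= \sum_(j <- G) a j.
Proof.
by move=> /fsubsetP FG; apply: ler_sum_subseq.
Qed.

(** The net of the finite sums is monotone, so its limit is its supremum. *)
Lemma summability_sum_sup (B : R) : (forall F : {fset int}, \sum_(j <- F) a j <= B) ->
  exists s : R, [/\ summability.sum (fun j => (a j)%:C : R[i]^o) = s%:C,
    forall F : {fset int}, \sum_(j <- F) a j <= s &
    forall e, 0 < e -> exists F : {fset int}, s - e < \sum_(j <- F) a j].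
Proof.
move=> aB; pose S := [set r | exists F : {fset int}, r = \sum_(j <- F) a j].
have supS : has_sup S.
  by split; [exists (\sum_(j <- fset0) a j), fset0|exists B => _ [F ->]].
exists (sup S); split=> [|F|e e0]; last 2 first.
- by apply: sup_upper_bound => //; exists F.
- by have [_ [F ->] lt_e] := sup_adherent e0 supS; exists F.
have totallyF : ProperFilter (@summability.totally int) := @summability.totally_filter int.
apply: cvg_lim; first exact: norm_hausdorff.
apply/(@cvgrPdist_lt _ R[i]^o) => e; case: e => e e' /=; rewrite ltcE /= => /andP[/eqP -> e0].
have [_ [F ->] lt_e] := sup_adherent e0 supS.
exists F => // G /= FG; rewrite fset_partial_sumE -rmorphB normCE normc_real ltcR.
have := fset_sum_le FG; have : \sum_(j <- G) a j <= sup S by apply: sup_upper_bound => //; exists G.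
move=> h1 h2; rewrite ger0_norm; lra.
Qed.

End NonnegativeSum.

Section HypothesisReading.
Variable R : realType.

Lemma lipschitz_circleP (f : R[i] -> R[i]) :
  [lipschitz (f : R[i]^o -> R[i]^o) z | z in @circle R] ->
  exists2 K : R, 0 <= K & forall u v : R[i], circle u -> circle v ->
    normc (f u - f v) <= K * normc (u - v).
Proof.
move=> [M [Mr /(_ (M + 1))]]; rewrite ltrDl ltr01 => /(_ isT) lipM.
have /complex_realP[k kE] : M + 1 \is Num.real by rewrite rpredD// rpred1.
exists `|k| => // u v cu cv; have := lipM (u, v) (conj cu cv).
rewrite /= kE !normCE -rmorphM lecR => /le_trans; apply.
by rewrite ler_wpM2r ?normc_ge0// ler_norm.
Qed.

Lemma continuous_circleP (f : R[i] -> R[i]) :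
  {within @circle R, continuous (f : R[i]^o -> R[i]^o)} ->
  forall c : R[i], circle c -> forall e : R, 0 < e ->
  exists2 d : R, 0 < d & forall w : R[i], circle w -> normc (w - c) < d ->
    normc (f w - f c) < e.
Proof.
move=> fc c cc e e0.
have := fc c; rewrite /continuous_at /= => /(@cvgrPdist_lt _ R[i]^o).
have e0' : 0 < e%:C by rewrite ltcR.
move=> /(_ _ e0') fe.
have : within (@circle R) (nbhs (c : R[i]^o)) [set t | `|f c - f t| < e%:C].
  by rewrite (nbhs_subspace_in cc).
move=> /nbhs_ballP[d]; case: d => d d'; rewrite /= ltcE /= => /andP[/eqP -> d0] fd.
exists d => // w cw wd; rewrite -ltcR -normCE distrC.
by apply: fd => //; rewrite /ball /= distrC normCE ltcR.
Qed.

Lemma continuous_circle_bounded (f : R[i] -> R[i]) :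
  (forall c : R[i], circle c -> forall e : R, 0 < e ->
    exists2 d : R, 0 < d & forall w : R[i], circle w -> normc (w - c) < d ->
    normc (f w - f c) < e) ->
  exists M : R, forall z : R[i], circle z -> normc (f z) <= M.
Proof.
move=> fc; pose F (t : R) := normc (f (expi t)).
have Fc : continuous F.
  move=> t; apply/cvgrPdist_lt => e e0.
  have [d d0 fd] := fc _ (circle_expi t) e e0.
  have d2 : 0 < d / 2 by rewrite divr_gt0.
  apply: (filterS _ (nbhsx_ballx t (d / 2) d2)) => u tu.
  have : normc (f (expi u) - f (expi t)) < e.
    apply: fd; first exact: circle_expi.
    rewrite (le_lt_trans (expi_lip _ _))// mulrC -ltr_pdivlMr// distrC.
    exact: tu.
  rewrite /F; have := ler_normcB (f (expi t)) (f (expi u)) 0.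
  have := ler_normcB (f (expi u)) (f (expi t)) 0; rewrite !subr0 (normcBC (f (expi t))).
  by move=> h1 h2 h3; rewrite ltr_norml; apply/andP; split; lra.
have [c _ cM] := EVT_max (ge0_cp (pi_ge0 R)).2 (continuous_subspaceT Fc).
by exists (F c) => z /expi_surj[t -> tI]; exact: cM.
Qed.

End HypothesisReading.

(** * N-th roots and periodic orbits of the power map *)

Section NthRoots.
Variables (R : realType) (N : nat).
Implicit Types z w : R[i].

(** A list rather than a set, so that the transfer operator becomes an ordinary sum. *)
Definition nth_roots z : seq R[i] := fset_set [set w | w ^+ N = z].

Lemma finite_nth_roots z : (0 < N)%N -> finite_set [set w | w ^+ N = z].
Proof.
move=> N0; have [r pE] := closed_field_poly_normal ('X^N - z%:P).
apply: (@sub_finite_set _ _ [set` r]); last exact: finite_seq.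
move=> w /= wz; have : root ('X^N - z%:P) w.
  by rewrite /root !hornerE wz subrr.
rewrite pE rootZ ?lead_coef_eq0 -?size_poly_eq0 ?size_XnsubC//.
by rewrite root_prod_XsubC.
Qed.

Lemma mem_nth_roots z w : (0 < N)%N -> (w \in nth_roots z) = (w ^+ N == z).
Proof.
move=> N0; rewrite /nth_roots in_fset_set; last exact: finite_nth_roots.
by apply/idP/eqP => [/set_mem|/mem_set].
Qed.

Lemma uniq_nth_roots z : uniq (nth_roots z).
Proof. exact: fset_uniq. Qed.

Lemma ruelleE (m0 f : R[i] -> R[i]) z : (0 < N)%N ->
  ruelle N m0 f z = \sum_(w <- nth_roots z) (normc (m0 w) ^+ 2 / N%:R)%:C * f w.
Proof.
move=> N0; rewrite /ruelle fsbig_finite; last exact: finite_nth_roots.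
rewrite mulr_sumr; apply: eq_bigr => w _.
rewrite sqr_normC mulrA; congr (_ * _).
have -> : N%:R^-1 = (N%:R^-1)%:C :> R[i] by rewrite fmorphV rmorph_nat.
by rewrite -rmorphM mulrC.
Qed.

End NthRoots.

Section CycleSequences.
Variables (R : realType) (N : nat).
Implicit Types (z : R[i]) (s : seq R[i]).

Lemma period_mul z q k : z ^+ (N ^ q) = z -> z ^+ (N ^ (k * q)) = z.
Proof.
by move=> zq; elim: k => [|k IH]; rewrite ?mul0n ?expr1// mulSn expnD exprM zq.
Qed.

Lemma iter_pow z n : iter n (fun w => w ^+ N) z = z ^+ (N ^ n).
Proof. by elim: n => [|n IH] /=; rewrite ?expr1// IH -exprM -expnSr. Qed.

Lemma fcycle_nth s k : fcycle (fun w : R[i] => w ^+ N) s -> (k < size s)%N ->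
  s`_0 ^+ (N ^ k) = s`_k.
Proof.
case: s => // x s; rewrite /= => /(pathP 0) sp.
elim: k => [|k IH] ks; first by rewrite expr1.
rewrite expnSr exprM IH; last exact: ltnW.
have := sp k; rewrite size_rcons => /(_ (ltnW ks)) /eqP.
move: ks => /=; rewrite !ltnS => ks.
by rewrite nth_rcons ks -rcons_cons nth_rcons /= ltnS (ltnW ks) => ->.
Qed.

Lemma fcycle_period s : fcycle (fun w : R[i] => w ^+ N) s -> s <> [::] ->
  s`_0 ^+ (N ^ size s) = s`_0.
Proof.
case: s => // x s sp _ /=; rewrite expnSr exprM.
rewrite (fcycle_nth (s := x :: s) (k := size s))//.
move: sp => /= /(pathP 0) /(_ (size s)); rewrite size_rcons ltnSn => /(_ isT) /eqP.
by rewrite nth_rcons ltnn eqxx -rcons_cons nth_rcons /= ltnSn.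
Qed.

(** It makes the point at which a labelling starts irrelevant. *)
Lemma fcycle_mem s c : fcycle (fun w : R[i] => w ^+ N) s -> c \in s ->
  [/\ exists k, c = s`_0 ^+ (N ^ k), exists k, s`_0 = c ^+ (N ^ k) & c ^+ (N ^ size s) = c].
Proof.
move=> sp cs; have s0 : s <> [::] by move=> s0; rewrite s0 in cs.
have [i i_lt cE] : exists2 i, (i < size s)%N & c = s`_0 ^+ (N ^ i).
  by exists (index c s); rewrite ?index_mem// fcycle_nth ?index_mem// nth_index.
split; first by exists i.
  exists (size s - i)%N; rewrite cE -exprM -expnD subnKC ?(ltnW i_lt)//.
  by rewrite fcycle_period.
by rewrite cE -exprM mulnC exprM fcycle_period.
Qed.

Lemma fcycle_closed s c k : fcycle (fun w : R[i] => w ^+ N) s -> c \in s ->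
  c ^+ (N ^ k) \in s.
Proof.
move=> sp cs; elim: k => [|k IH]; first by rewrite expr1.
rewrite expnSr exprM; have := next_cycle sp IH => /eqP ->.
by rewrite mem_next.
Qed.

Lemma fcycle_eq_set s t c : fcycle (fun w : R[i] => w ^+ N) s ->
  fcycle (fun w : R[i] => w ^+ N) t -> c \in s -> c \in t -> [set` s] = [set` t].
Proof.
move=> sp tp cs ct; apply/seteqP; split=> w /= ws.
  have [_ [k1 s0] _] := fcycle_mem sp cs; have [[k2 ->] _ _] := fcycle_mem sp ws.
  by rewrite s0 -exprM -expnD fcycle_closed.
have [_ [k1 t0] _] := fcycle_mem tp ct; have [[k2 ->] _ _] := fcycle_mem tp ws.
by rewrite t0 -exprM -expnD fcycle_closed.
Qed.

(** The orbit is listed up to its least period, so that no point is repeated. *)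
Lemma periodic_orbit_labelling (m0 : R[i] -> R[i]) z q : (0 < q)%N ->
  z ^+ (N ^ q) = z ->
  (forall j, circle (z ^+ (N ^ j)) /\ `|m0 (z ^+ (N ^ j))| = sqrtC N%:R) ->
  exists2 s, m0_cycle_labelling N m0 s & z \in s.
Proof.
move=> q0 zq zm; have ex : exists q, (0 < q)%N && (z ^+ (N ^ q) == z).
  by exists q; rewrite q0 zq eqxx.
case: (ex_minnP ex) => p /andP[p0 /eqP zp] pmin.
pose f := fun w : R[i] => w ^+ N.
exists (traject f z p); last by rewrite -(prednK p0) mem_head.
split.
- by rewrite -(prednK p0).
- have uniq_lt i j : (i < j)%N -> (j < p)%N -> z ^+ (N ^ i) <> z ^+ (N ^ j).
    move=> ij jp e; have := pmin (p - j + i)%N; rewrite addn_gt0 subn_gt0 jp /=.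
    rewrite (_ : _ == z); last first.
      by rewrite addnC expnD exprM e -exprM -expnD subnKC ?zp// ltnW.
    by move=> /(_ isT); lia.
  rewrite -(size_traject f z p); apply/(uniqP z) => i j; rewrite !inE !size_traject => ip jp.
  rewrite !nth_traject// !iter_pow => e.
  have [ij|ji|//] := ltngtP i j; exfalso; first exact: (uniq_lt _ _ ij jp e).
  exact: (uniq_lt _ _ ji ip (esym e)).
- rewrite -(prednK p0) /=; rewrite (_ : rcons _ _ = traject f (f z) p).
    exact: fpath_traject.
  by rewrite -[in RHS](prednK p0) trajectSr -iterSr prednK// iter_pow zp.
- by move=> w /trajectP[j _ ->]; rewrite iter_pow; exact: zm.
Qed.

(** A product over the orbit of a cycle may start at any of its points; this is why the
    same phase theta_C serves all k. *)
Lemma fcycle_perm (s : seq R[i]) c : fcycle (fun w : R[i] => w ^+ N) s -> uniq s -> c \in s ->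
  perm_eq s [seq c ^+ (N ^ j) | j <- iota 0 (size s)].
Proof.
move=> sp us cs; have [[a cE] [b sE] cp] := fcycle_mem sp cs.
have cmod m : c ^+ (N ^ m) = c ^+ (N ^ (m %% size s)).
  by rewrite {1}(divn_eq m (size s)) expnD exprM period_mul.
set L := map _ _; have sL : {subset s <= L}.
  move=> w ws; have [[k ->] _ _] := fcycle_mem sp ws.
  rewrite sE -exprM -expnD cmod; apply/mapP; exists ((b + k) %% size s)%N => //.
  by rewrite mem_iota /= add0n ltn_mod; case: (s) cs.
have sz : size L = size s by rewrite size_map size_iota.
have [] := uniq_min_size us sL; first by rewrite sz.
move=> _ sLi; apply: uniq_perm => //.
by rewrite (uniq_size_uniq us sLi) sz.
Qed.

End CycleSequences.

(** * The backward walk of a normalized filter *)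

Section Filter.
Variables (R : realType) (N : nat) (mu : R[i] -> R[i]) (kappa : R).
Hypothesis N_gt1 : (1 < N)%N.
Let N_gt0 : (0 < N)%N := ltnW N_gt1.
Hypothesis mu_lip : forall u v : R[i], circle u -> circle v ->
  normc (mu u - mu v) <= kappa * normc (u - v).
Hypothesis kappa_ge0 : 0 <= kappa.
Hypothesis mu_norm : forall z : R[i], circle z ->
  \sum_(w <- nth_roots N z) normc (mu w) ^+ 2 = 1.
Implicit Types (z w c : R[i]) (x y : R).

(** The transition probability of the backward walk to the root w of w ^+ N. *)
Definition weight w : R := normc (mu w) ^+ 2.
(** The probability that n steps of the walk started at w ^+ (N ^ n) end at w, through
    w ^+ (N ^ n.-1), ..., w ^+ N. *)
Definition path_weight n w : R := normc (iter_filter N mu n w) ^+ 2.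

Lemma weight_ge0 w : 0 <= weight w.
Proof. exact: sqr_ge0. Qed.

Lemma circle_root w : circle (w ^+ N) -> circle w.
Proof.
rewrite !circleE normcX => /eqP; rewrite -[X in _ == X](expr1n _ N) eqrXn2 ?normc_ge0//.
by move/eqP.
Qed.

Lemma circle_nth_roots z w : circle z -> w \in nth_roots N z -> circle w.
Proof. by move=> zc; rewrite mem_nth_roots// => /eqP wz; apply: circle_root; rewrite wz. Qed.

Lemma weight_le1 w : circle w -> weight w <= 1.
Proof.
move=> wc; rewrite -(mu_norm (circleX N wc)) (bigD1_seq w) ?uniq_nth_roots ?mem_nth_roots//=.
by rewrite lerDl sumr_ge0// => i _; exact: sqr_ge0.
Qed.

Lemma normc_mu_le1 w : circle w -> normc (mu w) <= 1.
Proof. by move=> /weight_le1; rewrite /weight expr_le1 ?normc_ge0. Qed.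

Lemma iter_filterD n m w :
  iter_filter N mu (n + m) w = iter_filter N mu n w * iter_filter N mu m (w ^+ (N ^ n)).
Proof.
rewrite /iter_filter big_split_ord /=; congr (_ * _).
by apply: eq_bigr => j _; rewrite -exprM expnD.
Qed.

Lemma path_weightD n m w :
  path_weight (n + m) w = path_weight n w * path_weight m (w ^+ (N ^ n)).
Proof. by rewrite /path_weight iter_filterD normcM exprMn. Qed.

Lemma iter_filter1 w : iter_filter N mu 1 w = mu w.
Proof. by rewrite /iter_filter big_ord1 expr1. Qed.

Lemma path_weight1 w : path_weight 1 w = weight w.
Proof. by rewrite /path_weight iter_filter1. Qed.

Lemma path_weight_ge0 n w : 0 <= path_weight n w.
Proof. exact: sqr_ge0. Qed.

Lemma normc_iter_filter_le1 n w : circle w -> normc (iter_filter N mu n w) <= 1.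
Proof.
move=> wc; rewrite normc_prod (@Num.Theory.prodr_ile1 R)// => j _.
by rewrite normc_ge0 normc_mu_le1//; exact: circleX.
Qed.

Lemma path_weight_le1 n w : circle w -> path_weight n w <= 1.
Proof. by move=> wc; rewrite expr_le1 ?normc_ge0 ?normc_iter_filter_le1. Qed.

Lemma natX_gt0 n : 0 < N%:R ^+ n :> R.
Proof. by rewrite exprn_gt0// ltr0n. Qed.

(** The branch of the N^n-th root of c^(N^n) expi x that tends to c. *)
Definition backward n c x : R[i] := c * expi (x / N%:R ^+ n).

Lemma circle_backward n c x : circle c -> circle (backward n c x).
Proof. by move=> cc; apply: circleM => //; exact: circle_expi. Qed.

Lemma backwardX n m c x : (n <= m)%N ->
  backward m c x ^+ (N ^ n) = backward (m - n) (c ^+ (N ^ n)) x.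
Proof.
move=> nm; rewrite /backward exprMn expiX; congr (_ * expi _).
have -> : N%:R ^+ m = N%:R ^+ (m - n) * N%:R ^+ n :> R by rewrite -exprD subnK.
by rewrite natrX; field; rewrite -!natrX !pnatr_eq0 -!lt0n !expn_gt0 N_gt0.
Qed.

(** The j-th factor is evaluated at points N^j |x - y| / N^n apart up to a constant, and
    these distances add up to at most |x - y|: the bound is uniform in n. *)
Lemma iter_filter_lip n c x y : circle c ->
  normc (iter_filter N mu n (backward n c x) - iter_filter N mu n (backward n c y))
    <= 2 * kappa * `|x - y|.
Proof.
move=> cc; pose a x j := mu (backward n c x ^+ (N ^ j)).
have acirc (z : R) j : circle (backward n c z ^+ (N ^ j)).
  by apply: circleX; exact: circle_backward.
have a1 (z : R) j : normc (a z j) <= 1 by exact: normc_mu_le1.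
apply: (le_trans (normc_prod_dist (a := a x) (b := a y) _ _ _)) => //.
have step (j : 'I_n) : normc (a x j - a y j) <=
    2 * kappa * `|x - y| / N%:R ^+ n * (N ^ j)%:R.
  rewrite (le_trans (mu_lip _ _))// !backwardX ?(ltnW (ltn_ord j))//.
  rewrite /backward -mulrBr normcM normcX.
  rewrite [X in X ^+ _](_ : _ = 1) ?expr1n ?mul1r; last by rewrite circleE in cc.
  have -> : 2 * kappa * `|x - y| / N%:R ^+ n * (N ^ j)%:R =
     kappa * (2 * `|x / N%:R ^+ (n - j) - y / N%:R ^+ (n - j)|).
    rewrite -mulrBl normrM normfV (ger0_norm (ltW (natX_gt0 _))).
    have -> : N%:R ^+ n = N%:R ^+ (n - j) * N%:R ^+ j :> R.
      by rewrite -exprD subnK// ltnW.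
    by rewrite natrX; field; rewrite !gt_eqF ?natX_gt0.
  by rewrite ler_wpM2l// expi_lip.
apply: (le_trans (ler_sum _ (fun i _ => step i))).
rewrite -mulr_sumr -natr_sum -[leLHS]mulrA -[leRHS]mulr1 ler_wpM2l ?mulr_ge0//.
by rewrite mulrC ler_pdivrMr ?natX_gt0// mul1r -natrX ler_nat sum_expn_le.
Qed.

Lemma path_weight_lip n c x y : circle c ->
  `|path_weight n (backward n c x) - path_weight n (backward n c y)|
    <= 4 * kappa * `|x - y|.
Proof.
move=> cc; rewrite /path_weight subr_sqr normrM.
have := iter_filter_lip n x y cc.
set u := iter_filter _ _ _ _; set v := iter_filter _ _ _ _ => uv.
have u1 : normc u <= 1 by exact/normc_iter_filter_le1/circle_backward.
have v1 : normc v <= 1 by exact/normc_iter_filter_le1/circle_backward.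
have := ler_normcB v u 0; have := ler_normcB u v 0; rewrite !subr0 (normcBC v u).
move=> h1 h2; have u0 := normc_ge0 u; have v0 := normc_ge0 v.
have -> : 4 * kappa * `|x - y| = (2 * kappa * `|x - y|) * 2 by ring.
rewrite ler_pM//; first by rewrite ler_norml; apply/andP; split; lra.
by rewrite ger0_norm ?addr_ge0//; lra.
Qed.

Variable P : nat.
Hypothesis P_gt0 : (0 < P)%N.

(** P is a common period of all the cycles; one period for all cycles lets the walk be
    observed at the same times n * P near each of them. *)
Definition cycle_point c :=
  [/\ circle c, c ^+ (N ^ P) = c & forall j, weight (c ^+ (N ^ j)) = 1].

Lemma cycle_point_iter c n : cycle_point c -> cycle_point (c ^+ (N ^ n)).
Proof.
case=> cc cP cw; split; first exact: circleX.
  by rewrite -!exprM mulnC exprM cP.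
by move=> j; rewrite -exprM -expnD.
Qed.

Lemma cycle_point_period c n : cycle_point c -> c ^+ (N ^ (n * P)) = c.
Proof.
case=> _ cP _; elim: n => [|n IH]; first by rewrite mul0n expr1.
by rewrite mulSn expnD exprM cP.
Qed.

Lemma cycle_point_path_weight n c : cycle_point c -> path_weight n c = 1.
Proof.
case=> cc cP cw; rewrite /path_weight normc_prod -prodrXl big1// => j _.
exact: cw.
Qed.

Lemma div_natX_cvg0 x q : (0 < q)%N ->
  x / N%:R ^+ (n * q) @[n --> \oo] --> (0 : R).
Proof.
move=> q0; rewrite -[0](mulr0 x); apply: cvgMr.
rewrite (_ : (fun n => _) = GRing.exp (N%:R ^- q)); last first.
  by apply/funext => n; rewrite exprVn -exprM mulnC.
apply: cvg_expr; rewrite ger0_norm ?invr_ge0 ?(ltW (natX_gt0 _))//.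
by rewrite invf_lt1 ?natX_gt0// exprn_egt1 ?lt0n_neq0// ltr1n.
Qed.

Lemma backward_cvg c x : circle c ->
  normc (backward (n * P) c x - c) @[n --> \oo] --> (0 : R).
Proof.
rewrite circleE => cc.
apply: (squeeze_cvg0 (g := fun n => 2 * `|x / N%:R ^+ (n * P)|)) => [n|].
  rewrite normc_ge0 /= /backward.
  rewrite -[X in _ - X]mulr1 -mulrBr normcM cc mul1r -expi0.
  by rewrite (le_trans (expi_lip _ _))// subr0.
rewrite -[X in _ --> X](mulr0 2); apply: cvgMr.
by rewrite -[X in _ --> X](normr0 R); apply: cvg_norm; exact: div_natX_cvg0.
Qed.

(** The probability that the walk started at c expi x follows, during n * P steps, the
    branch that converges to c; [hit] is the probability that it does so forever. *)
Definition approx_hit n c x := path_weight (n * P) (backward (n * P) c x).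
Definition hit c x : R := limn (fun n => approx_hit n c x).

(** Lengthening the path multiplies its probability by P further weights. *)
Lemma approx_hit_noninc c x : cycle_point c ->
  nonincreasing_seq (fun n => approx_hit n c x).
Proof.
move=> cp; have [cc cP _] := cp; apply/nonincreasing_seqP => n; rewrite /approx_hit mulSn.
rewrite path_weightD backwardX ?leq_addr// addKn cP.
by rewrite ler_piMl ?path_weight_ge0 ?path_weight_le1//; exact: circle_backward.
Qed.

Lemma is_cvg_approx_hit c x : cycle_point c -> cvgn (fun n => approx_hit n c x).
Proof.
move=> cp; apply: nonincreasing_is_cvgn; first exact: approx_hit_noninc.
by exists 0 => _ [n _ <-]; exact: path_weight_ge0.
Qed.

Lemma hit_ge0 c x : cycle_point c -> 0 <= hit c x.
Proof.
move=> cp; apply: limr_ge; first exact: is_cvg_approx_hit.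
by apply: nearW => n; exact: path_weight_ge0.
Qed.

Lemma hit_le1 c x : cycle_point c -> hit c x <= 1.
Proof.
move=> cp; have [cc _ _] := cp; apply: limr_le; first exact: is_cvg_approx_hit.
by apply: nearW => n; apply: path_weight_le1; exact: circle_backward.
Qed.

Lemma hit0 c : cycle_point c -> hit c 0 = 1.
Proof.
move=> cp; apply: cvg_lim => //; rewrite (_ : (fun n => _) = cst 1); first exact: cvg_cst.
apply/funext => n; rewrite /approx_hit /backward mul0r expi0 mulr1.
exact: cycle_point_path_weight.
Qed.

Lemma hit_lip c x y : cycle_point c -> `|hit c x - hit c y| <= 4 * kappa * `|x - y|.
Proof.
move=> cp; have [cc _ _] := cp.
have hx := @is_cvg_approx_hit c x cp; have hy := @is_cvg_approx_hit c y cp.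
have : `|approx_hit n c x - approx_hit n c y| @[n --> \oo] --> `|hit c x - hit c y|.
  by apply: cvg_norm; apply: cvgB.
move=> h; rewrite -(cvg_lim _ h)//; apply: limr_le.
  by apply/cvg_ex; exists `|hit c x - hit c y|.
by apply: nearW => n; exact: path_weight_lip.
Qed.

(** The first step: from (c expi x)^N the walk must go to c expi x, then follow the branch
    of c. *)
Lemma hit_next c x : cycle_point c ->
  hit (c ^+ N) (N%:R * x) = weight (c * expi x) * hit c x.
Proof.
move=> cp; have [cc cP cw] := cp.
have cNp : cycle_point (c ^+ N) by rewrite -[N]expn1; exact: cycle_point_iter.
pose v n := backward (n * P) c x.
have vE n : backward 1 c (N%:R * x / N%:R ^+ (n * P)) = v n.
  rewrite /v /backward expr1; congr (_ * expi _).
  by field; rewrite pnatr_eq0 -lt0n N_gt0 gt_eqF// natX_gt0.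
have vN n : (v n) ^+ N = backward (n * P) (c ^+ N) (N%:R * x).
  by rewrite /v /backward exprMn expiX; congr (_ * expi _); ring.
have vP n : (v n) ^+ (N ^ (n * P)) = c * expi x.
  by rewrite /v backwardX// subnn cycle_point_period// /backward divr1.
(* Both sides are the weight of the path of length n * P + 1 that ends at v n, with one
   factor split off at either end. *)
have eqn n : weight (v n) * approx_hit n (c ^+ N) (N%:R * x) =
    weight (c * expi x) * approx_hit n c x.
  rewrite /approx_hit -vN -path_weight1 -[X in _ ^+ X]expn1 -path_weightD addnC.
  by rewrite path_weightD vP path_weight1 mulrC.
have wv : weight (v n) @[n --> \oo] --> (1 : R).
  apply/subr_cvg0/norm_cvg0P.
  apply: (squeeze_cvg0 (g := fun n => 4 * kappa * `|N%:R * x / N%:R ^+ (n * P)|)) => [n|].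
    rewrite normr_ge0 /=.
    have := @path_weight_lip 1 c (N%:R * x / N%:R ^+ (n * P)) 0 cc.
    rewrite vE subr0 !path_weight1 /backward mul0r expi0 mulr1.
    by rewrite -[c in weight c]expr1 (cw 0) distrC.
  rewrite -[X in _ --> X](mulr0 (4 * kappa)).
  apply: cvgMr; rewrite -[X in _ --> X](normr0 R); apply: cvg_norm; exact: div_natX_cvg0.
have l1 : weight (v n) * approx_hit n (c ^+ N) (N%:R * x) @[n --> \oo] -->
    1 * hit (c ^+ N) (N%:R * x).
  by apply: cvgM => //; exact: is_cvg_approx_hit.
have l2 : weight (v n) * approx_hit n (c ^+ N) (N%:R * x) @[n --> \oo] -->
    weight (c * expi x) * hit c x.
  under eq_fun do rewrite eqn.
  by apply: cvgMr; exact: is_cvg_approx_hit.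
by rewrite -(cvg_lim _ l2)// (cvg_lim _ l1)// mul1r.
Qed.

Section Eigenfunction.
Variables (lambda : R[i]) (H : R[i] -> R[i]) (M : R).
Hypothesis H_bound : forall z, circle z -> normc (H z) <= M.
Hypothesis H_eigen : forall z, circle z ->
  \sum_(w <- nth_roots N z) (weight w)%:C * H w = lambda * H z.

(** After n steps the eigenvalue equation writes lambda^n H z as an average of H over the
    N^n-th roots of z; the roots outside [s] carry the remaining mass. *)
Lemma path_sum_bound n z (s : seq R[i]) : circle z -> uniq s ->
  (forall w, w \in s -> w ^+ (N ^ n) = z) ->
  normc (lambda ^+ n * H z - \sum_(w <- s) (path_weight n w)%:C * H w)
    <= M * (1 - \sum_(w <- s) path_weight n w).
Proof.
elim: n z s => [|n IH] z s zc us sz.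
  have p0 w : path_weight 0 w = 1 by rewrite /path_weight /iter_filter big_ord0 normc1 expr1n.
  case: s us sz => [|w s] us sz.
    by rewrite !big_nil !subr0 mul1r mulr1 H_bound.
  have wz : w = z by rewrite -(sz w) ?mem_head.
  have s0 : s = [::].
    case: s us sz => // v s; rewrite /= inE negb_or => /andP[/andP[wv _] _] sz.
    have := sz v; rewrite !inE eqxx orbT expr1 => /(_ isT) vz.
    by rewrite vz wz eqxx in wv.
  by rewrite s0 !big_seq1 p0 wz !mul1r !subrr normc0 mulr0.
(* The N^(n+1)-th roots of z are grouped according to the root u of z above which they lie. *)
have fib (V : nmodType) (F : R[i] -> V) : \sum_(w <- s) F w =
    \sum_(u <- nth_roots N z) \sum_(w <- [seq w <- s | w ^+ (N ^ n) == u]) F w.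
  rewrite [RHS](eq_bigr (fun u => \sum_(w <- s | w ^+ (N ^ n) == u) F w)); last first.
    by move=> u _; rewrite big_filter.
  rewrite (exchange_big_dep xpredT)//= big_seq [RHS]big_seq; apply: eq_bigr => w ws.
  rewrite -big_filter (_ : [seq u <- _ | _] = [:: w ^+ (N ^ n)]) ?big_seq1//.
  have uf : uniq [seq u <- nth_roots N z | w ^+ (N ^ n) == u].
    by rewrite filter_uniq// uniq_nth_roots.
  apply: perm_small_eq => //; apply: uniq_perm => // u.
  transitivity ((w ^+ (N ^ n) == u) && (u \in nth_roots N z)); first exact: mem_filter.
  rewrite mem_seq1; apply/andP/eqP => [[/eqP ->]//|->]; split; first exact/eqP.
  by rewrite mem_nth_roots// -exprM -expnSr sz ?eqxx.
have pw u w : w ^+ (N ^ n) = u -> path_weight n.+1 w = weight u * path_weight n w.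
  by move=> wu; rewrite -addn1 path_weightD wu path_weight1 mulrC.
have fs (V : nmodType) (F G : R[i] -> V) u :
   (forall w, w ^+ (N ^ n) = u -> F w = G w) ->
   \sum_(w <- [seq w <- s | w ^+ (N ^ n) == u]) F w =
   \sum_(w <- [seq w <- s | w ^+ (N ^ n) == u]) G w.
  by move=> FG; rewrite !big_filter; apply: eq_bigr => w /eqP/FG.
rewrite exprSr -mulrA -H_eigen// mulr_sumr !fib -[in leRHS](mu_norm zc) -!sumrB.
rewrite (le_trans (ler_normc_sum _ _ _))// mulr_sumr big_seq [leRHS]big_seq.
apply: ler_sum => u ur; have uc := circle_nth_roots zc ur.
rewrite (fs _ _ (fun w => (weight u)%:C * ((path_weight n w)%:C * H w))); last first.
  by move=> w wu; rewrite (pw u)// rmorphM mulrA.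
rewrite (fs _ _ (fun w => weight u * path_weight n w)); last exact: pw.
rewrite -!mulr_sumr mulrCA -mulrBr normcM normc_real ger0_norm ?weight_ge0//.
rewrite -/(weight u) (_ : forall b a q : R, b * (a - a * q) = a * (b * (1 - q))); last first.
  by move=> b a q; ring.
rewrite ler_wpM2l ?weight_ge0//.
apply: IH => //; first exact: filter_uniq.
by move=> w; rewrite mem_filter => /andP[/eqP].
Qed.

(** At a point of a cycle the backward walk is deterministic, so the bound with the single
    root c has no error term. *)
Lemma cycle_point_eigen c n : cycle_point c ->
  lambda ^+ n * H (c ^+ (N ^ n)) = H c.
Proof.
move=> cp; have [cc _ _] := cp.
have := @path_sum_bound n (c ^+ (N ^ n)) [:: c] (circleX _ cc) isT.
rewrite !big_seq1 cycle_point_path_weight// subrr mulr0 mul1r => /(_ _)/wrap[].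
  by move=> w; rewrite mem_seq1 => /eqP ->.
move=> le0; apply/eqP; rewrite -subr_eq0; apply/eqP/eq0_normc/eqP.
by rewrite eq_le le0 normc_ge0.
Qed.

(** Equality would make c / d equal to expi of a quantity that tends to 0: impossible when
    c <> d, and when c = d it forces this quantity to be 0. *)
Lemma backward_neq (p q : R[i] * R) : circle p.1 -> circle q.1 -> p != q ->
  \forall n \near \oo, backward (n * P) p.1 p.2 != backward (n * P) q.1 q.2.
Proof.
case: p q => [c x] [d y] /= cc dc pq.
have key n : backward (n * P) c x = backward (n * P) d y ->
    c / d = expi ((y - x) / N%:R ^+ (n * P)).
  rewrite /backward => e; rewrite mulrBl expiD expiN.
  have := circle_neq0 dc; have := circle_neq0 (circle_expi (x / N%:R ^+ (n * P))).
  move=> n1 n2; apply: (mulIf n1); rewrite mulrAC e mulrVK//.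
  by rewrite mulrAC mulfV// mul1r.
have lim0 := div_natX_cvg0 (y - x) P_gt0.
have [cd|cd] := eqVneq c d.
  have xy : y - x != 0 by apply: contraNneq pq => /eqP; rewrite subr_eq0 => /eqP ->; rewrite cd.
  near=> n; apply/eqP => /key; rewrite cd mulfV ?circle_neq0// => /esym/expi_eq1_small.
  have small : `|(y - x) / N%:R ^+ (n * P)| < 1.
    by near: n; apply: cvgr0_norm_lt lim0 _ ltr01.
  move=> /(_ small)/eqP; rewrite mulf_eq0 (negbTE xy)/= invr_eq0.
  by rewrite gt_eqF// natX_gt0.
have d0 : 0 < normc (c / d - 1).
  rewrite lt_neqAle normc_ge0 andbT eq_sym; apply/eqP => /eq0_normc/eqP.
  by rewrite subr_eq0 => /eqP cd1; move: cd; rewrite -(divfK (circle_neq0 dc) c) cd1 mul1r eqxx.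
have d2 : 0 < normc (c / d - 1) / 2 by rewrite divr_gt0.
near=> n; apply/eqP => /key e.
have := expi_lip ((y - x) / N%:R ^+ (n * P)) 0; rewrite expi0 -e subr0.
apply/negP; rewrite -ltNge.
rewrite mulrC -ltr_pdivlMr//; near: n; exact: cvgr0_norm_lt lim0 _ d2.
Unshelve. all: by end_near. Qed.

Lemma uniq_backward (s : seq (R[i] * R)) : uniq s -> (forall q, q \in s -> circle q.1) ->
  \forall n \near \oo, uniq [seq backward (n * P) q.1 q.2 | q <- s].
Proof.
elim: s => [_ _|p s IH /= /andP[ps us] sc]; first exact: nearW.
have {}IH := IH us (fun q qs => sc q (@mem_behead _ (p :: s) q qs)).
have pc := sc p (mem_head p s).
have far (t : seq (R[i] * R)) : p \notin t -> (forall q, q \in t -> circle q.1) ->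
    \forall n \near \oo, backward (n * P) p.1 p.2 \notin [seq backward (n * P) q.1 q.2 | q <- t].
  elim: t => [_ _|q t IHt]; first exact: nearW.
  rewrite inE negb_or => /andP[pq pt] tc.
  have ptn := IHt pt (fun r rt => tc r (@mem_behead _ (q :: t) r rt)).
  have pqn := backward_neq pc (tc q (mem_head q t)) pq.
  by near=> n; rewrite inE negb_or; apply/andP; split; near: n.
have psn := far s ps (fun q qs => sc q (@mem_behead _ (p :: s) q qs)).
by near=> n; apply/andP; split; near: n.
Unshelve. all: by end_near. Qed.

Hypothesis lambda_circle : circle lambda.
Hypothesis H_cont : forall c, circle c -> forall e, 0 < e ->
  exists2 d : R, 0 < d & forall w, circle w -> normc (w - c) < d -> normc (H w - H c) < e.

Lemma H_backward_cvg c x : circle c ->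
  normc (H (backward (n * P) c x) - H c) @[n --> \oo] --> (0 : R).
Proof.
move=> cc; apply/norm_cvg0P/cvgr0Pnorm_lt => e e0.
have [d d0 Hd] := H_cont cc e0.
near=> n; rewrite normr_id ger0_norm ?normc_ge0//.
apply: Hd; first exact: circle_backward.
have : `|normc (backward (n * P) c x - c)| < d.
  by near: n; apply: cvgr0_norm_lt (backward_cvg x cc) _ d0.
by rewrite ger0_norm ?normc_ge0.
Unshelve. all: by end_near. Qed.

(** The limit of [path_sum_bound] for the endpoints of the lifts: their path weights tend
    to [hit] and, by continuity, the values of H at the endpoints tend to H c. *)
Lemma cycle_sum_bound z (s : seq (R[i] * R)) : circle z -> uniq s ->
  (forall q, q \in s -> cycle_point q.1 /\ q.1 * expi q.2 = z) ->
  normc (H z - \sum_(q <- s) (hit q.1 q.2)%:C * H q.1)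
    <= M * (1 - \sum_(q <- s) hit q.1 q.2).
Proof.
move=> zc us sz; set X := normc _.
pose b n (q : R[i] * R) := `|approx_hit n q.1 q.2 - hit q.1 q.2| * M
   + normc (H (backward (n * P) q.1 q.2) - H q.1).
pose rhs n := M * (1 - \sum_(q <- s) approx_hit n q.1 q.2) + \sum_(q <- s) b n q.
have rhs_cvg : rhs n @[n --> \oo] --> M * (1 - \sum_(q <- s) hit q.1 q.2).
  rewrite -[X in _ --> X]addr0; apply: cvgD.
    apply: cvgMr; apply: cvgB; first exact: cvg_cst.
    by apply: cvg_sum_seq => q /sz[cq _]; exact: is_cvg_approx_hit.
  have s0 : \sum_(q <- s) (0 : R) = 0 by rewrite big1.
  rewrite -[X in _ --> X]s0.
  apply: cvg_sum_seq => q /sz[cq _]; have [cc _ _] := cq.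
  rewrite -[X in _ --> X]addr0; apply: cvgD; last exact: H_backward_cvg.
  rewrite -[X in _ --> X](mul0r M); apply: cvgMl; apply/norm_cvg0P/subr_cvg0.
  exact: is_cvg_approx_hit.
rewrite -(cvg_lim _ rhs_cvg)//; apply: limr_ge; first by apply/cvg_ex; eexists; exact: rhs_cvg.
have nun := uniq_backward us (fun q qs => (let: conj (And3 cc _ _) _ := sz q qs in cc)).
near=> n; have un : uniq [seq backward (n * P) q.1 q.2 | q <- s] by near: n.
have -> : X = normc (lambda ^+ (n * P) * H z - \sum_(q <- s) (hit q.1 q.2)%:C * H q.1).
  have l1 : normc (lambda ^+ (n * P)) = 1.
    by rewrite normcX; move: lambda_circle; rewrite circleE => ->; rewrite expr1n.
  rewrite /X -[LHS]mul1r -l1 -normcM mulrBr mulr_sumr; congr (normc (_ - _)).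
  rewrite big_seq [RHS]big_seq; apply: eq_bigr => q /sz[cq _].
  by rewrite mulrCA; have := cycle_point_eigen (n * P) cq; rewrite cycle_point_period// => ->.
set S := \sum_(q <- s) (approx_hit n q.1 q.2)%:C * H (backward (n * P) q.1 q.2).
rewrite (le_trans (ler_normcB S _ _))//.
rewrite lerD//.
  have := @path_sum_bound (n * P) z _ zc un; rewrite !big_map; apply.
  move=> w /mapP[q /sz[cq qz] ->].
  by rewrite backwardX// subnn cycle_point_period// /backward divr1.
rewrite -sumrB (le_trans (ler_normc_sum _ _ _))// big_seq [leRHS]big_seq.
apply: ler_sum => q /sz[cq _]; have [cc _ _] := cq.
rewrite /b; set A := approx_hit _ _ _; set B := hit _ _; set u := H _; set v := H _.
have -> : A%:C * u - B%:C * v = (A - B)%:C * u + B%:C * (u - v).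
  by rewrite rmorphB /=; ring.
rewrite (le_trans (ler_normcD _ _))// !normcM !normc_real lerD//.
  by rewrite ler_wpM2l// H_bound//; exact: circle_backward.
rewrite ler_piMl ?normc_ge0// ger0_norm ?hit_ge0// /B.
exact: hit_le1.
Unshelve. all: by end_near. Qed.

End Eigenfunction.

(** A pair (c, x) stands for the path that is absorbed at c along c expi (x / N^n). *)
Definition lifts z (s : seq (R[i] * R)) :=
  uniq s /\ forall q, q \in s -> cycle_point q.1 /\ q.1 * expi q.2 = z.

Definition hit_total z : R :=
  sup [set r | exists2 s, lifts z s & r = \sum_(q <- s) hit q.1 q.2].

Lemma hit_sum_le1 z s : circle z -> lifts z s -> \sum_(q <- s) hit q.1 q.2 <= 1.
Proof.
move=> zc [us sz].
have := @cycle_sum_bound 1 (fun=> 1) 1 _ _ (circle1 R) _ z s zc us sz.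
move=> /(_ _ _ _)/wrap[w _|w wc|c _ e e0|le1].
- by rewrite normc1.
- under eq_bigr do rewrite mulr1.
  have := congr1 (real_complex R) (mu_norm wc); rewrite rmorph_sum rmorph1 mulr1.
  exact.
- by exists 1 => // w _ _; rewrite subrr normc0.
  by have := le_trans (normc_ge0 _) le1; rewrite mul1r subr_ge0.
Qed.

Lemma hit_total_has_sup z : circle z ->
  has_sup [set r | exists2 s, lifts z s & r = \sum_(q <- s) hit q.1 q.2].
Proof.
move=> zc; split; first by exists 0, [::]; rewrite ?big_nil.
by exists 1 => _ [s sz ->]; exact: (hit_sum_le1 zc sz).
Qed.

Lemma hit_sum_le_total z s : circle z -> lifts z s ->
  \sum_(q <- s) hit q.1 q.2 <= hit_total z.
Proof.
by move=> zc sz; apply: sup_upper_bound; [exact: hit_total_has_sup|exists s].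
Qed.

Lemma hit_total_adherent z e : circle z -> 0 < e ->
  exists2 s, lifts z s & hit_total z - e < \sum_(q <- s) hit q.1 q.2.
Proof.
by move=> zc e0; have [_ [s sz ->] es] := sup_adherent e0 (hit_total_has_sup zc); exists s.
Qed.

Lemma hit_total_le1 z : circle z -> hit_total z <= 1.
Proof.
move=> zc; apply: sup_le_ub; first by have [] := hit_total_has_sup zc.
by move=> _ [s sz ->]; exact: (hit_sum_le1 zc sz).
Qed.

Lemma hit_total_cycle_point c : cycle_point c -> 1 <= hit_total c.
Proof.
move=> cp; have [cc _ _] := cp.
have -> : 1 = \sum_(q <- [:: (c, 0 : R)]) hit q.1 q.2 by rewrite big_seq1 hit0.
apply: hit_sum_le_total => //; split=> // q; rewrite mem_seq1 => /eqP ->.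
by rewrite /= expi0 mulr1.
Qed.

Lemma cycle_point_next_inj c d : cycle_point c -> cycle_point d ->
  c ^+ N = d ^+ N -> c = d.
Proof.
case=> _ cP _ [_ dP _] cd; rewrite -cP -dP -(prednK P_gt0) expnS !exprM cd//.
Qed.

(** Lifts of the different roots of z extend to distinct lifts of z, by the map
    (c, x) |-> (c^N, N x). *)
Lemma hit_total_super z : circle z ->
  \sum_(w <- nth_roots N z) weight w * hit_total w <= hit_total z.
Proof.
move=> zc; apply/ler_addgt0Pr => e e0.
have /choice[S HS] : forall w, exists s, circle w ->
    lifts w s /\ hit_total w - e < \sum_(q <- s) hit q.1 q.2.
  move=> w; have [wc|wc] := pselect (circle w); last by exists [::].
  by have [s s1 s2] := hit_total_adherent wc e0; exists s.
pose next (q : R[i] * R) := (q.1 ^+ N, N%:R * q.2).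
pose s := [seq next q | w <- nth_roots N z, q <- S w].
have liftsS w : w \in nth_roots N z -> lifts w (S w).
  by move=> wr; have [] := HS w (circle_nth_roots zc wr).
have sz : lifts z s.
  split.
    apply: allpairs_uniq_dep => [|w wr|]; first exact: uniq_nth_roots.
      by have [] := liftsS w wr.
    move=> _ _ /allpairsPdep[w [q [wr qS ->]]] /allpairsPdep[w' [q' [wr' qS' ->]]].
    rewrite /= /next => -[e1 e2].
    have [cq qw] := (liftsS w wr).2 q qS; have [cq' qw'] := (liftsS w' wr').2 q' qS'.
    have qq : q = q'.
      move: e1 e2 cq cq'; case: (q) (q') => [c x] [d y] /= e1 e2 cq cq'.
      congr pair; first exact: cycle_point_next_inj.
      by apply: (mulfI _ e2); rewrite pnatr_eq0 -lt0n.
    have ww : w = w' by rewrite -qw -qw' qq.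
    by subst.
  move=> _ /allpairsPdep[w [q [wr qS ->]]] /=.
  have [cq qw] := (liftsS w wr).2 q qS; split.
    by have := cycle_point_iter 1 cq; rewrite expn1.
  by rewrite mulrC [N%:R * _]mulrC -expiX -exprMn mulrC qw; apply/eqP; rewrite -mem_nth_roots.
have sumE : \sum_(q <- s) hit q.1 q.2 =
    \sum_(w <- nth_roots N z) weight w * \sum_(q <- S w) hit q.1 q.2.
  rewrite big_allpairs_dep /= big_seq [RHS]big_seq; apply: eq_bigr => w wr.
  rewrite mulr_sumr big_seq [RHS]big_seq; apply: eq_bigr => q qS.
  by have [cq qw] := (liftsS w wr).2 q qS; rewrite hit_next// qw.
apply: (@le_trans _ _ (\sum_(q <- s) hit q.1 q.2 + e)); last first.
  by rewrite lerD2r hit_sum_le_total.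
rewrite sumE -[e in leRHS]mul1r -(mu_norm zc) mulr_suml -big_split /=.
rewrite big_seq [leRHS]big_seq; apply: ler_sum => w wr.
rewrite -mulrDr ler_wpM2l ?weight_ge0// -lerBlDr ltW//.
by have [] := HS w (circle_nth_roots zc wr).
Qed.

(** Shifting the second components of finitely many lifts of z gives lifts of nearby points
    with almost the same sum; a supremum of such sums is lower semicontinuous. *)
Lemma hit_total_lsc z a : circle z -> a < hit_total z ->
  exists2 d : R, 0 < d & forall x, `|x| < d -> a < hit_total (z * expi x).
Proof.
move=> zc az; have e0 : 0 < hit_total z - a by rewrite subr_gt0.
have [s [us sz]] := hit_total_adherent zc e0.
rewrite subKr => as_; set S := \sum_(q <- s) _ in as_.
(* Each of the [size s] terms is Lipschitz; the summand 1 only keeps K positive. *)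
pose K := (size s)%:R * (4 * kappa) + 1.
have K0 : 0 < K by rewrite ltr_wpDl// !mulr_ge0.
exists ((S - a) / K); first by rewrite divr_gt0// subr_gt0.
move=> x; rewrite ltr_pdivlMr// => xK.
pose s' := [seq (q.1, q.2 + x) | q <- s].
have s'z : lifts (z * expi x) s'.
  split.
    rewrite map_inj_uniq// => -[c u] [d v] /= [-> /eqP]; rewrite (inj_eq (addIr _)) => /eqP ->//.
  move=> _ /mapP[q /sz[cq qz] ->] /=; split=> //.
  by rewrite expiD mulrA qz.
apply: (lt_le_trans _ (hit_sum_le_total (circleM zc (circle_expi x)) s'z)).
rewrite big_map /=.
have : S - \sum_(q <- s) hit q.1 (q.2 + x) <= (size s)%:R * (4 * kappa) * `|x|.
  rewrite -sumrB -mulrA mulr_natl.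
  have -> : (4 * kappa * `|x|) *+ size s = \sum_(q <- s) (4 * kappa * `|x|).
    by rewrite big_const_seq count_predT iter_addr_0.
  rewrite big_seq [leRHS]big_seq.
  apply: ler_sum => q /sz[cq _]; rewrite (le_trans (ler_norm _))//.
  by rewrite (le_trans (hit_lip _ _ cq))// opprD addNKr normrN.
have x0 := normr_ge0 x; move: xK; rewrite /K mulrDr mulr1 (mulrC `|x|).
lra.
Qed.

(** A cluster point of a minimizing sequence in [-pi, pi] is a minimum, by lower
    semicontinuity. *)
Lemma hit_total_min : exists2 z, circle z & forall w, circle w -> hit_total z <= hit_total w.
Proof.
pose I := `[(- pi), pi]%classic : set R.
pose m := inf [set hit_total (expi t) | t in I].
have piI : I pi by rewrite /I /= in_itv /= lexx andbT ge0_cp// pi_ge0.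
have mI : has_inf [set hit_total (expi t) | t in I].
  split; first by exists (hit_total (expi pi)), pi.
  exists 0 => _ [t _ <-]; have ct := circle_expi t.
  by have := @hit_sum_le_total (expi t) [::] ct; rewrite big_nil; apply.
have m_le t : I t -> m <= hit_total (expi t).
  by move=> It; apply: inf_lbound; [exact: mI.2|exists t].
have /choice[t Ht] : forall n : nat, exists t, I t /\ hit_total (expi t) < m + n.+1%:R^-1.
  move=> n; have [|_ [t It <-] lt_t] := @inf_adherent _ _ (n.+1%:R^-1) _ mI.
    by rewrite invr_gt0.
  by exists t.
have [|p [Ip clp]] := @segment_compact R (- pi) pi (t @ \oo) _.
  have : \forall n \near \oo, I (t n) by apply: nearW => n; exact: (Ht n).1.
  exact.
exists (expi p); first exact: circle_expi.
move=> w /expi_surj[u -> Iu]; apply: (le_trans _ (m_le u Iu)).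
rewrite leNgt; apply/negP => mp.
have [d d0 near_p] := hit_total_lsc (circle_expi p) (midf_lt mp).2.
have [|u' [/= u1 u2]] := clp [set u | hit_total (expi u) < (m + hit_total (expi p)) / 2]
  (ball p d) _ (nbhsx_ballx p d d0).
  have e0 : 0 < (m + hit_total (expi p)) / 2 - m by rewrite subr_gt0 (midf_lt mp).1.
  have : \forall n \near \oo, n.+1%:R^-1 < (m + hit_total (expi p)) / 2 - m.
    exact: near_infty_natSinv_lt (PosNum e0).
  apply: filterS => n /=; rewrite ltrBrDl; apply: lt_trans; exact: (Ht n).2.
have : (m + hit_total (expi p)) / 2 < hit_total (expi p * expi (u' - p)).
  by apply: near_p; rewrite distrC; move: u2; rewrite /ball /=.
by rewrite -expiD [p + _]addrC subrK => /(lt_trans u1); rewrite ltxx.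
Qed.

(** * Convergence of the infinite products *)

Section PhaseProduct.
Variables (c e : R[i]) (p : nat) (x : R).
Hypothesis c_cycle : cycle_point c.
Hypothesis p_gt0 : (0 < p)%N.
Hypothesis p_dvd : (p %| P)%N.
Hypothesis c_period : c ^+ (N ^ p) = c.
Hypothesis e_circle : circle e.
Hypothesis e_phase : e * iter_filter N mu p c = 1.

(** The partial products of phi in closed form: n * p factors of the filter, read along the
    backward branch, and n phases. *)
Definition phase_prod y n := e ^+ n * iter_filter N mu (n * p) (backward (n * p) c y).

Lemma phase_prodE y n : phase_prod y n =
  \prod_(1 <= l < n.+1) (e * iter_filter N mu p (backward (l * p) c y)).
Proof.
elim: n => [|n IH]; first by rewrite big_geq// /phase_prod /iter_filter big_ord0 mul1r.
rewrite big_nat_recr//= -IH /phase_prod mulSn iter_filterD backwardX ?leq_addr// addKn.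
rewrite c_period exprS.
by ring.
Qed.

(** The tail of the product is the product itself, at the rescaled argument. *)
Lemma phase_prodD y n m : phase_prod y (n + m) =
  phase_prod y n * phase_prod (y / N%:R ^+ (n * p)) m.
Proof.
rewrite /phase_prod addnC mulnDl iter_filterD backwardX ?leq_addr// addKn.
have -> : c ^+ (N ^ (m * p)) = c.
  by elim: (m) => [|k IH]; rewrite ?mul0n ?expr1// mulSn expnD exprM c_period.
have -> : backward (m * p + n * p) c y = backward (m * p) c (y / N%:R ^+ (n * p)).
  rewrite /backward; congr (_ * expi _); rewrite exprD.
  by field; rewrite !gt_eqF ?natX_gt0.
by rewrite exprD; ring.
Qed.

Lemma phase_prod0 n : phase_prod 0 n = 1.
Proof.
rewrite phase_prodE big1// => l _.
by rewrite /backward mul0r expi0 mulr1.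
Qed.

Lemma normc_phase_prod y n :
  normc (phase_prod y n) ^+ 2 = path_weight (n * p) (backward (n * p) c y).
Proof.
by rewrite /phase_prod normcM normcX; move: e_circle; rewrite circleE => ->; rewrite expr1n mul1r.
Qed.

Lemma phase_prod_dist n m :
  normc (phase_prod x (n + m) - phase_prod x n) <= 2 * kappa * `|x / N%:R ^+ (n * p)|.
Proof.
have [cc _ _] := c_cycle.
rewrite phase_prodD -[X in _ - X]mulr1 -mulrBr normcM.
have le1 : normc (phase_prod x n) <= 1.
  have := path_weight_le1 (n * p) (circle_backward (n * p) x cc).
  by rewrite -normc_phase_prod expr_le1 ?normc_ge0.
rewrite (le_trans (ler_piMl (normc_ge0 _) le1))// -(phase_prod0 m) /phase_prod -mulrBr.
rewrite normcM normcX.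
move: e_circle; rewrite circleE => ->; rewrite expr1n mul1r.
by rewrite (le_trans (iter_filter_lip _ _ _ cc))// subr0.
Qed.

(** The tail differs from its value 1 at 0 by at most a multiple of |x| / N^(n p), hence the
    Cauchy property.  The squared moduli agree, along the multiples of P / p, with
    the sequence that defines [hit]. *)
Lemma phase_prod_cvg : exists l : R[i],
  (phase_prod x n : R[i]^o) @[n --> \oo] --> (l : R[i]^o) /\ normc l ^+ 2 = hit c x.
Proof.
have cvx : 2 * kappa * `|x / N%:R ^+ (n * p)| @[n --> \oo] --> (0 : R).
  rewrite -[X in _ --> X](mulr0 (2 * kappa)); apply: cvgMr.
  rewrite -[X in _ --> X](normr0 R); apply: cvg_norm.
  exact: div_natX_cvg0.
have [l ul] := cauchy_rate_cvg_complex phase_prod_dist cvx.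
exists l; split; first exact: cvg_complexP.
have nul : normc (phase_prod x n) @[n --> \oo] --> normc l.
  apply/subr_cvg0/norm_cvg0P; apply: squeeze_cvg0 ul => n; rewrite normr_ge0 /=.
  have := ler_normcB l (phase_prod x n) 0; have := ler_normcB (phase_prod x n) l 0.
  by rewrite !subr0 (normcBC _ l) ler_norml => h1 h2; apply/andP; split; lra.
have nul2 : normc (phase_prod x n) ^+ 2 @[n --> \oo] --> normc l ^+ 2.
  by rewrite expr2; under eq_fun do rewrite expr2; exact: cvgM.
have kr : (k * (P %/ p))%N @[k --> \oo] --> \oo.
  move=> S [n0 _ nS]; exists n0 => // k /= nk; apply: nS => /=.
  by rewrite (leq_trans nk)// leq_pmulr// divn_gt0// dvdn_leq.
apply: (cvg_unique _ (cvg_comp _ _ kr nul2)) => //.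
rewrite (_ : _ \o _ = fun n => approx_hit n c x); first exact: is_cvg_approx_hit.
by apply/funext => k; rewrite /= normc_phase_prod /approx_hit -mulnA divnK.
Qed.

End PhaseProduct.

(** * Absorption by the cycles is almost sure *)

Hypothesis finite_zeros : finite_set [set w | circle w /\ weight w = 0].
Hypothesis cycle_complete : forall z q, circle z -> (0 < q)%N -> z ^+ (N ^ q) = z ->
  (forall j, weight (z ^+ (N ^ j)) = 1) -> z ^+ (N ^ P) = z.
Hypothesis weight1 : forall j, weight (1 ^+ (N ^ j)) = 1.

Let cycle_point1 : cycle_point 1.
Proof. by split=> //; [exact: circle1|rewrite expr1n]. Qed.

Lemma exists_weight_neq0 z : circle z ->
  exists2 w, w \in nth_roots N z & weight w != 0.
Proof.
move=> zc; apply: contrapT => nex.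
have := mu_norm zc; rewrite big1_seq => [/esym/eqP|w /= wr]; first by rewrite oner_eq0.
by apply/eqP/negPn/negP => w0; apply: nex; exists w.
Qed.

(** Two visits to z of the same forward orbit would make z periodic. *)
Lemma level_bound z : (forall q, (0 < q)%N -> z ^+ (N ^ q) <> z) -> forall Z : seq R[i],
  exists K, forall v k, v \in Z -> v ^+ (N ^ k) = z -> (k <= K)%N.
Proof.
move=> nper; elim=> [|v Z [K HK]]; first by exists 0%N.
have [[k0 yk0]|nk] := pselect (exists k, v ^+ (N ^ k) = z); last first.
  exists K => u k; rewrite in_cons => /predU1P[-> yk|]; last exact: HK.
  by exfalso; apply: nk; exists k.
exists (maxn k0 K) => u k; rewrite in_cons leq_max.
move=> /predU1P[-> yk|uZ /(HK _ _ uZ) ->]; last by rewrite orbT.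
have [//|kk0] := leqP k k0; exfalso.
apply: (nper (k - k0)%N); first by rewrite subn_gt0.
by rewrite -{1}yk0 -exprM -expnD subnKC// ltnW.
Qed.

(** The set A is meant to be the set of minima of [hit_total]. *)
Section BackwardInvariant.
Variable A : set R[i].
Hypothesis A_circle : forall z, A z -> circle z.
Hypothesis A_back : forall z w, A z -> w \in nth_roots N z -> weight w != 0 -> A w.

Lemma backward_chain z n : A z -> exists2 u, A u & u ^+ (N ^ n) = z.
Proof.
move=> Az; elim: n => [|n [u Au uz]]; first by exists z; rewrite ?expr1.
have [w wr w0] := exists_weight_neq0 (A_circle Au).
exists w; first exact: A_back Au wr w0.
by rewrite expnS exprM; move: wr; rewrite mem_nth_roots// => /eqP ->.
Qed.

(** A nonperiodic z sees the zeros of the weight at levels bounded by some K; a point K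
    levels further back that is reached through positive weights sees none. *)
Lemma zero_free_or_periodic z : A z ->
  (exists2 u, A u & forall n w, w ^+ (N ^ n.+1) = u -> weight w != 0) \/
  (exists2 q, (0 < q)%N & z ^+ (N ^ q) = z).
Proof.
move=> Az; have [per|nper] := pselect (exists2 q, (0 < q)%N & z ^+ (N ^ q) = z); first by right.
left; have /finite_seqP[Z ZE] := finite_zeros.
have [K HK] : exists K, forall v k, v \in Z -> v ^+ (N ^ k) = z -> (k <= K)%N.
  by apply: level_bound => q q0 zq; apply: nper; exists q.
have [u Au uz] := backward_chain K Az; exists u => // n w wu.
apply/negP => /eqP w0; have : (n.+1 + K <= K)%N; last by lia.
apply: (HK w); last by rewrite expnD exprM wu.
have : [set` Z] w; last by [].
rewrite -ZE; split=> //; rewrite circleE.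
have := A_circle Au; rewrite -wu circleE normcX => /eqP.
by rewrite -[X in _ == X](expr1n _ (N ^ n.+1)) eqrXn2 ?normc_ge0 ?expn_gt0 ?N_gt0// => /eqP.
Qed.

Lemma zero_free_to1 t n : A (expi t) ->
  (forall k w, w ^+ (N ^ k.+1) = expi t -> weight w != 0) -> A (expi (t / N%:R ^+ n)).
Proof.
move=> At zf; elim: n => [|n IH]; first by rewrite divr1.
apply: A_back IH _ _; last first.
  apply: (zf n); rewrite expiX natrX mulfVK ?gt_eqF ?natX_gt0//.
rewrite mem_nth_roots// expiX exprS; apply/eqP; congr expi.
by field; rewrite pnatr_eq0 -lt0n N_gt0 gt_eqF// natX_gt0.
Qed.

Hypothesis A_periodic : forall z, A z -> exists2 q, (0 < q)%N & z ^+ (N ^ q) = z.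

(** All roots of positive weight of z lie in A, hence are periodic; but z has only one
    periodic root, which therefore carries the whole weight. *)
Lemma periodic_pred z q : A z -> (0 < q)%N -> z ^+ (N ^ q) = z ->
  A (z ^+ (N ^ q.-1)) /\ weight (z ^+ (N ^ q.-1)) = 1.
Proof.
move=> Az q0 zq; have zc := A_circle Az.
have yr : z ^+ (N ^ q.-1) \in nth_roots N z by rewrite mem_nth_roots// -exprM -expnSr prednK// zq.
have only w : w \in nth_roots N z -> weight w != 0 -> w = z ^+ (N ^ q.-1).
  move=> wr w0; have [q' q'0 wq'] := A_periodic (A_back Az wr w0).
  move: wr; rewrite mem_nth_roots// => /eqP wz.
  rewrite -{1}(period_mul q wq') (_ : q * q' = 1 + (q'.-1 * q + q.-1))%N; last by nia.
  by rewrite !expnD !exprM expn1 wz -[z ^+ (N ^ (q'.-1 * q))]/(_) (period_mul q'.-1 zq).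
have w1 : weight (z ^+ (N ^ q.-1)) = 1.
  rewrite -(mu_norm zc) (bigD1_seq (z ^+ (N ^ q.-1))) ?uniq_nth_roots//=.
  rewrite [X in _ = _ + X]big1_seq ?addr0// => w /andP[wy wr].
  by apply/eqP/negPn/negP => /(only w wr) wE; rewrite wE eqxx in wy.
by split=> //; apply: A_back Az yr _; rewrite w1 oner_neq0.
Qed.

(** On a periodic orbit the images of z are also reached by going backwards. *)
Lemma periodic_next z : A z -> A (z ^+ N) /\ weight z = 1.
Proof.
move=> Az; have [q q0 zq] := A_periodic Az.
(* Raising to the power N^(q-1) is one step backwards on an orbit of period q. *)
pose x i := z ^+ (N ^ (i * q.-1)).
have xq i : x i ^+ (N ^ q) = x i by rewrite /x -!exprM mulnC exprM zq.
have xS i : x i ^+ (N ^ q.-1) = x i.+1 by rewrite /x -exprM -expnD mulSn addnC.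
have xA i : A (x i).
  elim: i => [|i Ai]; first by rewrite /x mul0n expr1.
  by rewrite -xS; have [] := periodic_pred Ai q0 (xq i).
have xqz : x q = z by rewrite /x mulnC period_mul.
have zE : z = x q.-1 ^+ (N ^ q.-1) by rewrite xS prednK// xqz.
have [_ w1] := periodic_pred (xA q.-1) q0 (xq _).
by rewrite zE; split=> //; rewrite -exprM -expnSr prednK// xq.
Qed.

Lemma periodic_cycle_point z : A z -> cycle_point z.
Proof.
move=> Az; have [q q0 zq] := A_periodic Az.
have zA j : A (z ^+ (N ^ j)).
  elim: j => [|j IH]; first by rewrite expr1.
  by rewrite expnSr exprM; have [] := periodic_next IH.
have zw j : weight (z ^+ (N ^ j)) = 1 by have [] := periodic_next (zA j).
have zc := A_circle Az.
by split; [exact: zc|exact: (cycle_complete zc q0 zq zw)|exact: zw].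
Qed.

End BackwardInvariant.

(** The minima form a set closed under the roots of positive weight; such a set contains a
    point of a cycle or comes arbitrarily close to 1, itself a point of a cycle, and
    [hit_total] is at least 1 at these points. *)
Lemma hit_total1 z : circle z -> hit_total z = 1.
Proof.
move=> zc; apply/le_anti; rewrite hit_total_le1//=.
have [z0 z0c z0min] := hit_total_min; apply: le_trans (z0min z zc).
pose A w := circle w /\ hit_total w = hit_total z0.
have A_circle w : A w -> circle w by case.
have A_back u w : A u -> w \in nth_roots N u -> weight w != 0 -> A w.
  move=> [uc um] wr w0; have wc := circle_nth_roots uc wr; split=> //.
  apply/le_anti; rewrite z0min// andbT leNgt; apply/negP => mw.
  have := hit_total_super uc; rewrite um -[leRHS]mul1r -(mu_norm uc) mulr_suml.
  apply/negP; rewrite -ltNge.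
  rewrite (bigD1_seq w) ?uniq_nth_roots//= [ltRHS](bigD1_seq w) ?uniq_nth_roots//=.
  rewrite ltr_leD//; first by rewrite ltr_pM2l// lt_neqAle eq_sym w0 weight_ge0.
  rewrite big_seq_cond [leRHS]big_seq_cond; apply: ler_sum => v /andP[vr _].
  by rewrite ler_wpM2l ?weight_ge0// z0min//; exact: circle_nth_roots vr.
rewrite leNgt; apply/negP => m1.
have A_periodic w : A w -> exists2 q, (0 < q)%N & w ^+ (N ^ q) = w.
  move=> Aw; have [[u Au zf]|//] := zero_free_or_periodic A_circle A_back Aw; exfalso.
  have [t ut _] := expi_surj (A_circle _ Au); subst u.
  have [d d0 near1] := hit_total_lsc (circle1 R)
    (lt_le_trans m1 (hit_total_cycle_point cycle_point1)).
  have [n _ /(_ n (leqnn n))] := cvgr0_norm_lt _ (div_natX_cvg0 t P_gt0) _ d0.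
  move=> /near1; rewrite mul1r => lt_n.
  by have [_ e] := zero_free_to1 A_back (n * P) Au zf; rewrite e ltxx in lt_n.
have Az0 : A z0 by [].
have := hit_total_cycle_point (periodic_cycle_point A_circle A_back A_periodic Az0).
by apply/negP; rewrite -ltNge.
Qed.

(** The solutions x of c expi x = z, indexed by the integers as in the sum Per. *)
Definition lift_point c z (j : int) : R := arg (c^-1 * z) + 2 * j%:~R * pi.

Lemma lift_pointE c z j : circle c -> circle z -> c * expi (lift_point c z j) = z.
Proof.
move=> cc zc; rewrite expiD expi2pi mulr1 expi_arg ?mulVKf ?circle_neq0//.
by apply: circleM => //; exact: circleV.
Qed.

Lemma lift_point_inj c z : injective (lift_point c z).
Proof.
move=> i j /addrI; rewrite -!mulrA => /mulfI; rewrite pnatr_eq0 => /(_ isT).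
by move=> /mulIf; rewrite gt_eqF ?pi_gt0// => /(_ isT)/intr_inj.
Qed.

Lemma lift_pointP c x z : circle c -> c * expi x = z -> exists j, x = lift_point c z j.
Proof.
move=> cc xz; have [|j jE] := @expi_eq1 R (x - arg (c^-1 * z)).
  rewrite expiD expiN -xz mulKf ?circle_neq0// expi_arg; last exact: circle_expi.
  by rewrite divff// circle_neq0//; exact: circle_expi.
by exists j; rewrite /lift_point -jE addrC subrK.
Qed.

Definition hit_series c z : R[i] :=
  summability.sum (fun j : int => (hit c (lift_point c z j))%:C : R[i]^o).

Lemma hit_series_sup c z : cycle_point c -> circle z ->
  exists s : R, [/\ hit_series c z = s%:C,
    forall F : {fset int}, \sum_(j <- F) hit c (lift_point c z j) <= s &
    forall e, 0 < e -> exists F : {fset int}, s - e < \sum_(j <- F) hit c (lift_point c z j)].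
Proof.
move=> cp zc; apply: (@summability_sum_sup _ _ _ 1) => [j|F]; first exact: hit_ge0.
have := @hit_sum_le1 z [seq (c, lift_point c z j) | j <- F] zc.
rewrite big_map; apply; split.
  by rewrite map_inj_uniq ?fset_uniq// => i j [/lift_point_inj].
by move=> _ /mapP[j _ ->]; split=> //; apply: lift_pointE => //; case: cp.
Qed.

Section Expansion.
Variables (lambda : R[i]) (H : R[i] -> R[i]) (M : R).
Hypothesis H_bound : forall z, circle z -> normc (H z) <= M.
Hypothesis H_eigen : forall z, circle z ->
  \sum_(w <- nth_roots N z) (weight w)%:C * H w = lambda * H z.
Hypothesis lambda_circle : circle lambda.
Hypothesis H_cont : forall c, circle c -> forall e, 0 < e ->
  exists2 d : R, 0 < d & forall w, circle w -> normc (w - c) < d -> normc (H w - H c) < e.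
Variable cyc : seq R[i].
Hypothesis cyc_uniq : uniq cyc.
Hypothesis cycP : forall c, c \in cyc <-> cycle_point c.

(** Since the total mass is 1, finitely many lifts make the bound of [cycle_sum_bound]
    arbitrarily small; adding lifts makes the sums over each c close to their limits
    without spoiling this bound. *)
Lemma eigenfunction_hit_series z : circle z ->
  H z = \sum_(c <- cyc) hit_series c z * H c.
Proof.
move=> zc; have /choice[gam gamP] : forall c, exists s : R, c \in cyc ->
    [/\ hit_series c z = s%:C,
    forall F : {fset int}, \sum_(j <- F) hit c (lift_point c z j) <= s &
    forall e, 0 < e -> exists F : {fset int}, s - e < \sum_(j <- F) hit c (lift_point c z j)].
  move=> c; have [/cycP cc|] := boolP (c \in cyc); last by exists 0.
  by have [s] := hit_series_sup cc zc; exists s.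
rewrite big_seq (eq_bigr (fun c => (gam c)%:C * H c)) => [|c /gamP[-> //]].
rewrite -big_seq; set T := \sum_(c <- cyc) _.
have M_ge0 : 0 <= M by rewrite (le_trans (normc_ge0 _) (H_bound zc)).
have approx e : 0 < e -> normc (H z - T) <= M * e + e * M *+ size cyc.
  move=> e0; have /choice[F FP] : forall c, exists F : {fset int}, c \in cyc ->
      gam c - e < \sum_(j <- F) hit c (lift_point c z j).
    move=> c; have [cc|] := boolP (c \in cyc); last by exists fset0.
    by have [_ _ /(_ e e0)[F HF]] := gamP c cc; exists F.
  have [s0 [us0 s0z] s0e] := hit_total_adherent zc e0.
  have /choice[J HJ] : forall q : R[i] * R, exists j : int, q \in s0 ->
      q.2 = lift_point q.1 z j.
    move=> q; have [/s0z[[cc _ _] qz]|] := boolP (q \in s0); last by exists 0.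
    by have [j] := lift_pointP cc qz; exists j.
  (* One finite set of integers serves all cycle points at once: it contains
     the indices met in [s0] and those of every [F c]. *)
  pose L := [seq J q | q <- s0] ++ [seq j | c <- cyc, j <- (F c : seq int)].
  pose G := [fset j | j in L]%fset.
  have GE j : (j \in G) = (j \in L) by rewrite in_fset.
  pose s := [seq (c, lift_point c z j) | c <- cyc, j <- (G : seq int)].
  have sz : lifts z s.
    split=> [|_ /allpairsP[[c j] [/= /cycP cp _ ->]]] /=; last first.
      by split=> //; apply: lift_pointE; case: cp.
    apply: allpairs_uniq => //; first exact: fset_uniq.
    move=> [c j] [c' j'] _ _ /= e'; have [cc' _] := e'; subst c'.
    by move: e' => [/lift_point_inj ->].
  have s0s : {subset s0 <= s}.
    move=> q qs0; have [cq _] := s0z q qs0.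
    apply/allpairsP; exists (q.1, J q); split=> /=.
    - exact/cycP.
    - by rewrite GE mem_cat map_f.
    - by rewrite -HJ//; case: (q).
  have total_s : 1 - e < \sum_(q <- s) hit q.1 q.2.
    rewrite -(hit_total1 zc); apply: (lt_le_trans s0e); apply: ler_sum_subseq => //.
      by case: sz.
    by move=> q /sz.2[cq _]; exact: hit_ge0.
  have bound := cycle_sum_bound H_bound H_eigen lambda_circle H_cont zc sz.1 sz.2.
  apply: (le_trans (ler_normcB _ _ _)); apply: lerD.
    by apply: (le_trans bound); rewrite ler_wpM2l//; lra.
  rewrite big_allpairs_dep /T -sumrB /=.
  have -> : e * M *+ size cyc = \sum_(c <- cyc) e * M.
    by rewrite big_const_seq count_predT iter_addr_0.
  apply: (le_trans (ler_normc_sum _ _ _)); rewrite big_seq [leRHS]big_seq.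
  apply: ler_sum => c cc; have [_ gam_ub _] := gamP c cc.
  have /cycP cp := cc; have [c1 _ _] := cp.
  rewrite -mulr_suml -rmorph_sum -mulrBl -rmorphB normcM normc_real.
  rewrite ler_pM ?normc_ge0//; last exact: H_bound.
  have FG : {subset F c <= G}.
    move=> j jF; rewrite GE mem_cat; apply/orP; right.
    by apply/allpairsPdep; exists c, j.
  have := FP c cc; have := gam_ub G.
  have : \sum_(j <- F c) hit c (lift_point c z j) <= \sum_(j <- G) hit c (lift_point c z j).
    apply: ler_sum_subseq => //; try exact: fset_uniq.
    by move=> j _; exact: hit_ge0.
  move: (\sum_(j <- F c) _) (\sum_(j <- G) _) (gam c) => a b g ab bg ga.
  by rewrite distrC ger0_norm ?subr_ge0//; lra.
apply/eqP; rewrite -subr_eq0; apply/eqP/eq0_normc/eqP; rewrite eq_le normc_ge0 andbT.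
apply/ler_addgt0Pr => e e0; rewrite add0r.
pose D := M + M *+ size cyc + 1; have D0 : 0 < D by rewrite ltr_wpDl// addr_ge0// mulrn_wge0.
apply: le_trans (approx (e / D) _) _; first exact: divr_gt0.
rewrite -mulr_natr (_ : _ + _ = e / D * (M + M *+ size cyc)); last first.
  by rewrite -[M *+ _]mulr_natr; ring.
by rewrite mulrAC ler_pdivrMr// ler_wpM2l ?(ltW e0)// lerDl.
Qed.

End Expansion.

End Filter.

(** * From the given filter to the normalized one *)

Section Assembly.
Variables (R : realType) (N : nat) (m0 : R[i] -> R[i]).
Hypothesis hN : (1 < N)%N.
Let N_gt0 : (0 < N)%N := ltnW hN.
Let rt : R[i] := sqrtC N%:R.
Let mu (w : R[i]) := m0 w / rt.

Lemma sqr_rt : rt ^+ 2 = N%:R. Proof. exact: sqrtCK. Qed.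

Lemma rt_neq0 : rt != 0.
Proof. by rewrite sqrtC_eq0 pnatr_eq0 -lt0n. Qed.

Lemma rt_real : rt = (normc rt)%:C.
Proof. by rewrite -normCE ger0_norm// sqrtC_ge0 ler0n. Qed.

Lemma normc_rt_sqr : normc rt ^+ 2 = N%:R.
Proof.
apply: complexI; rewrite rmorphXn /= -rt_real sqr_rt.
by rewrite rmorph_nat.
Qed.

Lemma normc_rt_gt0 : 0 < normc rt.
Proof.
rewrite lt_neqAle normc_ge0 andbT eq_sym; apply: contra rt_neq0 => /eqP/eq0_normc.
by move=> ->.
Qed.

Lemma weight_muE w : weight mu w = normc (m0 w) ^+ 2 / N%:R.
Proof. by rewrite /weight /mu normcM normcV exprMn exprVn normc_rt_sqr. Qed.

(** This identifies the condition |m0| = sqrt N in the definition of cycles. *)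
Lemma weight_mu_eq1 w : weight mu w = 1 <-> `|m0 w| = rt.
Proof.
have N0 : N%:R != 0 :> R by rewrite pnatr_eq0 -lt0n.
rewrite weight_muE rt_real normCE; split=> [e|/complexI ->]; last first.
  by rewrite normc_rt_sqr divff.
congr (_%:C); apply/eqP; rewrite -(@eqrXn2 _ 2) ?normc_ge0// normc_rt_sqr.
by rewrite -[X in X == _](divfK N0) e mul1r.
Qed.

Lemma iter_filter_mu p w : iter_filter N m0 p w / sqrtC (N%:R ^+ p) = iter_filter N mu p w.
Proof.
rewrite rootCX ?ler0n// /iter_filter /mu big_split /= prodr_const card_ord.
by rewrite exprVn.
Qed.

Variable kappa : R.
Hypothesis mu_lip : forall u v : R[i], circle u -> circle v ->
  normc (mu u - mu v) <= kappa * normc (u - v).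
Hypothesis kappa_ge0 : 0 <= kappa.
Hypothesis mu_norm : forall z : R[i], circle z ->
  \sum_(w <- nth_roots N z) normc (mu w) ^+ 2 = 1.
Variable P : nat.
Hypothesis P_gt0 : (0 < P)%N.

(** The phase theta_C is the one that makes the product over one period equal to 1 at c. *)
Lemma sqr_normc_phi (s : seq R[i]) k x : m0_cycle_labelling N m0 s -> (k < size s)%N ->
  (size s %| P)%N -> cycle_point N mu P s`_k ->
  `|phi N m0 s k x| ^+ 2 = (hit N mu P s`_k x)%:C.
Proof.
move=> [s0 us sp sm] ks pP cp; set c := s`_k; set p := size s.
have cs : c \in s by rewrite mem_nth.
have [_ _ c_per] := fcycle_mem sp cs.
pose e := expi (- theta_cycle m0 s) : R[i].
have e_phase : e * iter_filter N mu p c = 1.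
  rewrite /iter_filter -(big_mkord xpredT (fun j => mu (c ^+ (N ^ j)))) /index_iota subn0.
  rewrite -(big_map (fun j => c ^+ (N ^ j)) xpredT mu) -(perm_big _ (fcycle_perm sp us cs)) /=.
  rewrite /e /theta_cycle [X in _ * X]big_seq.
  rewrite [X in _ * X](eq_bigr (fun w => expi (arg (m0 w)))); last first.
    move=> w ws; have [_ mw] := sm w ws.
    by rewrite /mu {1}[m0 w]argP mw mulrAC divff ?mul1r// rt_neq0.
  by rewrite -big_seq -expi_sum -expiD addNr expi0.
have [l [ul lE]] := phase_prod_cvg hN mu_lip kappa_ge0 mu_norm P_gt0 x cp
  (leq_ltn_trans (leq0n k) ks) pP c_per (circle_expi _) e_phase.
have -> : phi N m0 s k x = l.
  transitivity (limn (fun n => phase_prod N mu c e p x n : R[i]^o)); last first.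
    exact: (@cvg_lim R[i]^o (@norm_hausdorff _ _) _ _ _ _ _ ul).
  have prodE n : \prod_(1 <= l < n.+1) (e * rotate_fun c (iter_filter N m0 p)
      (expi (x / N%:R ^+ (l * p))) / sqrtC (N%:R ^+ p)) = phase_prod N mu c e p x n.
    rewrite (phase_prodE mu hN e c_per); apply: eq_bigr => j _.
    by rewrite -mulrA iter_filter_mu.
  exact: (congr1 (fun f : nat -> R[i]^o => limn f) (funext prodE)).
by rewrite sqr_normC lE.
Qed.

Lemma g_hit_series (s : seq R[i]) k z : m0_cycle_labelling N m0 s -> (k < size s)%N ->
  (size s %| P)%N -> cycle_point N mu P s`_k ->
  g N m0 s k z = hit_series N mu P s`_k z.
Proof.
move=> sl ks pP cp; have phiE j : `|phi N m0 s k (lift_point s`_k z j)| ^+ 2 =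
    (hit N mu P s`_k (lift_point s`_k z j))%:C by exact: sqr_normc_phi.
exact: (congr1 (fun f : int -> R[i]^o => summability.sum f) (funext phiE)).
Qed.

End Assembly.

(** * The spectral theorem *)

Theorem theorem2p17 (R : realType) (N : nat) (m0 : R[i] -> R[i])
    (hN : (2 <= N)%N)
    (m0_lip : [lipschitz (m0 : R[i]^o -> R[i]^o) z | z in @circle R])
    (m0_zeros : finite_set (@circle R `&` [set z | m0 z = 0]))
    (m0_norm : forall z : R[i], circle z -> ruelle N m0 (fun=> 1) z = 1)
    (m0_1 : m0 1 = sqrtC N%:R)
    (n : nat) (C : 'I_n -> seq R[i])
    (C_cycle : forall i, m0_cycle_labelling N m0 (C i))
    (C_inj : injective (fun i => [set` C i]))
    (C_all : forall A : set R[i], m0_cycle N m0 A -> exists i, A = [set` C i])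
    (h : R[i] -> R[i])
    (h_cont : {within @circle R, continuous (h : R[i]^o -> R[i]^o)})
    (h_neq0 : exists2 z : R[i], circle z & h z != 0)
    (lambda : R[i]) (lambda_circle : circle lambda)
    (h_eigen : forall z : R[i], circle z -> ruelle N m0 h z = lambda * h z) :
  (exists i, lambda ^+ size (C i) = 1) /\
  (exists alpha : 'I_n -> R[i],
    (forall z : R[i], circle z ->
      h z = \sum_(i < n) alpha i *
        (\sum_(k < size (C i)) lambda ^- k * g N m0 (C i) k z)) /\
    (forall i, lambda ^+ size (C i) <> 1 -> alpha i = 0)).
Proof.
have N_gt0 : (0 < N)%N := ltnW hN.
pose mu (w : R[i]) := m0 w / sqrtC N%:R.
have [K K0 m0_lipK] := lipschitz_circleP m0_lip.
have rt0 := normc_rt_gt0 R hN.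
pose kappa := K / normc (sqrtC (N%:R : R[i])).
have kappa0 : 0 <= kappa by rewrite divr_ge0// ltW.
have mu_lip (u v : R[i]) : circle u -> circle v -> normc (mu u - mu v) <= kappa * normc (u - v).
  move=> cu cv; rewrite /mu -mulrBl normcM normcV /kappa mulrAC.
  by rewrite ler_wpM2r ?invr_ge0 ?(ltW rt0)// m0_lipK.
have ruelleW f (z : R[i]) : ruelle N m0 f z = \sum_(w <- nth_roots N z) (weight mu w)%:C * f w.
  by rewrite ruelleE//; apply: eq_bigr => w _; rewrite weight_muE.
have mu_norm (z : R[i]) : circle z -> \sum_(w <- nth_roots N z) normc (mu w) ^+ 2 = 1.
  move=> zc; apply: complexI; rewrite rmorph_sum /= -[RHS](m0_norm z zc) ruelleW.
  by apply: eq_bigr => w _; rewrite mulr1.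
have eigen (z : R[i]) : circle z -> \sum_(w <- nth_roots N z) (weight mu w)%:C * h w = lambda * h z.
  by move=> zc; rewrite -ruelleW h_eigen.
have weight_eq1 w : weight mu w = 1 <-> `|m0 w| = sqrtC N%:R by exact: weight_mu_eq1.
have Csize i : (0 < size (C i))%N by have [+ _ _ _] := C_cycle i; case: (C i).
(* Any common multiple of the lengths of the cycles would do. *)
pose P := (\prod_i size (C i))%N.
have P_gt0 : (0 < P)%N by rewrite prodn_gt0.
have dvdP i : (size (C i) %| P)%N by rewrite /P (bigD1 i)//= dvdn_mulr.
have Ccp i c : c \in C i -> cycle_point N mu P c.
  move=> ci; have [_ _ sp sm] := C_cycle i; have [_ _ cper] := fcycle_mem sp ci; split.
  - by have [] := sm c ci.
  - by rewrite -(divnK (dvdP i)) period_mul.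
  - by move=> j; apply/weight_eq1; have [] := sm _ (fcycle_closed j sp ci).
have cyc_mem (z : R[i]) q : circle z -> (0 < q)%N -> z ^+ (N ^ q) = z ->
    (forall j, weight mu (z ^+ (N ^ j)) = 1) -> exists i, z \in C i.
  move=> zc q0 zq zw; have [|s sl zs] := periodic_orbit_labelling (m0 := m0) q0 zq.
    by move=> j; split; [exact: circleX|exact/weight_eq1].
  have [|i sC] := C_all [set` s]; first by exists s.
  by exists i; have : [set` s] z by []; rewrite sC.
have zeros : finite_set [set w : R[i] | circle w /\ weight mu w = 0].
  apply: sub_finite_set m0_zeros => w /= [wc /eqP w0]; split=> //; move: w0.
  have N0 : N%:R != 0 :> R by rewrite pnatr_eq0 -lt0n.
  rewrite weight_muE// mulf_eq0 invr_eq0 (negbTE N0) orbF sqrf_eq0.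
  by move=> /eqP/eq0_normc.
have cont := continuous_circleP h_cont.
have [M h_le] := continuous_circle_bounded cont.
have heig i k : (k < size (C i))%N -> lambda ^+ k * h (C i)`_k = h (C i)`_0.
  move=> ki; have [_ _ sp _] := C_cycle i.
  rewrite -(fcycle_nth sp ki); apply: (cycle_point_eigen hN mu_norm h_le eigen).
  by apply: Ccp; apply: mem_nth.
have alpha0 i : lambda ^+ size (C i) <> 1 -> h (C i)`_0 = 0.
  move=> l1; have [s0 _ sp _] := C_cycle i.
  have := cycle_point_eigen hN mu_norm h_le eigen (size (C i)) (Ccp i _ (mem_nth 0 (Csize i))).
  rewrite fcycle_period// => /eqP; rewrite -subr_eq0 -{2}[h _]mul1r -mulrBl mulf_eq0 subr_eq0.
  by move=> /orP[/eqP//|/eqP].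
suff main (z : R[i]) : circle z -> h z = \sum_(i < n) h (C i)`_0 *
        (\sum_(k < size (C i)) lambda ^- k * g N m0 (C i) k z).
  split; last by exists (fun i => h (C i)`_0).
  apply: contrapT => nex; have [z zc] := h_neq0; rewrite main// big1 ?eqxx// => i _.
  by rewrite alpha0 ?mul0r// => l1; apply: nex; exists i.
move=> zc; pose cyc := [seq c | i <- enum 'I_n, c <- C i].
have cycP c : c \in cyc <-> cycle_point N mu P c.
  split=> [/allpairsPdep[i [d [_ di ->]]]|[cc cP cw]]; first exact: Ccp di.
  have [i ci] := cyc_mem c P cc P_gt0 cP cw.
  by apply/allpairsPdep; exists i, c; rewrite mem_enum.
have cyc_uniq : uniq cyc.
  apply: allpairs_uniq_dep => [|i _|]; first exact: enum_uniq.
    by have [] := C_cycle i.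
  move=> _ _ /allpairsPdep[i [c [_ ci ->]]] /allpairsPdep[i' [c' [_ ci' ->]]] /= cc'.
  subst c'; have [_ _ sp _] := C_cycle i; have [_ _ sp' _] := C_cycle i'.
  by have ii' := C_inj _ _ (fcycle_eq_set sp sp' ci ci'); subst i'.
have complete (w : R[i]) q : circle w -> (0 < q)%N -> w ^+ (N ^ q) = w ->
    (forall j, weight mu (w ^+ (N ^ j)) = 1) -> w ^+ (N ^ P) = w.
  by move=> wc q0 wq w1; have [i /Ccp[]] := cyc_mem w q wc q0 wq w1.
have weight1 j : weight mu (1 ^+ (N ^ j)) = 1.
  by rewrite expr1n; apply/weight_eq1; rewrite m0_1 ger0_norm// sqrtC_ge0 ler0n.
rewrite (eigenfunction_hit_series hN mu_lip kappa0 mu_norm P_gt0 zeros complete weight1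
  h_le eigen lambda_circle cont cyc_uniq cycP zc).
rewrite big_allpairs_dep /= big_enum; apply: eq_bigr => i _.
rewrite mulr_sumr (big_nth 0) big_mkord; apply: eq_bigr => k _.
have ki := ltn_ord k; have ci := mem_nth 0 ki.
rewrite -(heig i k ki) (g_hit_series hN mu_lip kappa0 mu_norm P_gt0)//; last exact: Ccp ci.
have l0 : lambda ^+ k != 0 by rewrite expf_neq0// circle_neq0.
by rewrite -/mu; field.
Qed.
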